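(* Let $BH^3_d(\hat{\mathcal F})$ denote the third bihamiltonian cohomology, in standard degree $d$, of the double complex $(\hat{\mathcal F},d_1,d_2)$ associated to the bihamiltonian structure $$\{u(x),u(y)\}_1=\delta'(x-y),\qquad \{u(x),u(y)\}_2=u(x)\delta'(x-y)+\tfrac12 u_x(x)\,\delta(x-y)$$ of the dispersionless KdV hierarchy, i.e. to the pair of Poisson bivectors $P_1=\frac12\int\theta\theta^1$, $P_2=\frac12\int u\,\theta\theta^1$. Then $BH^3_d(\hat{\mathcal F})=0$ for all $d\ge 4$.
   Context: Let $M=\mathbb R$ with coordinate $u=u^0$. Let $\hat{\mathcal A}$ be the supercommutative algebra generated by smooth functions of $u$, even variables $u^s$ ($s\ge1$) and odd variables $\theta^s$ ($s\ge 0$, $\theta^0=\theta$), which is polynomial in the variables $u^s,\theta^s$, $s\ge1$, and then completed with respect to the standard gradation: $\deg u^s=\deg\theta^s=s$ for $s\ge1$, $\deg f=0$ for $f$ a function of $u,\theta$. (Upper indices on $u^s,\theta^s$ denote jet variables, not powers.) The super gradation is $\deg\theta^s=1$, $\deg u^s=0$. $\hat{\mathcal A}^p_d$ is the subspace of elements of super degree $p$ and standard degree $d$ (zero if $p<0$ or $d<0$). The even derivation $\partial=\sum_{s\ge0}\left(u^{s+1}\frac{\partial}{\partial u^s}+\theta^{s+1}\frac{\partial}{\partial\theta^s}\right)$ acts on $\hat{\mathcal A}$. Put $\hat{\mathcal F}=\hat{\mathcal A}/\partial\hat{\mathcal A}$, with projection $\int:\hat{\mathcal A}\to\hat{\mathcal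 F}$ and induced bigraded pieces $\hat{\mathcal F}^p_d$. For $f\in\hat{\mathcal A}$ let $\delta^\theta f=\sum_{s\ge0}(-\partial)^s\frac{\partial f}{\partial\theta^s}$ and $\delta_u f=\sum_{s\ge0}(-\partial)^s\frac{\partial f}{\partial u^s}$ (left derivatives in odd variables); these are well defined on $\hat{\mathcal F}$. The Schouten bracket of $P\in\hat{\mathcal F}^p$, $Q\in\hat{\mathcal F}^q$ is $[P,Q]=\int\left(\delta^\theta P\,\delta_uQ+(-1)^p\delta_uP\,\delta^\theta Q\right)$. Put $d_a=[P_a,\cdot\,]:\hat{\mathcal F}^p_d\to\hat{\mathcal F}^{p+1}_{d+1}$, $a=1,2$; these satisfy $d_1^2=d_2^2=d_1d_2+d_2d_1=0$. Equivalently $d_a(\int f)=\int D_a f$ with the odd derivations $$D_1=\sum_{s\ge0}\theta^{s+1}\frac{\partial}{\partial u^s},\qquad D_2=\sum_{s\ge0}\left(\partial^s\left(u\theta^1+\tfrac12u^1\theta\right)\frac{\partial}{\partial u^s}+\partial^s\left(\tfrac12\theta\theta^1\right)\frac{\partial}{\partial\theta^s}\right).$$ The bihamiltonian cohomology is $$BH^p_d(\hat{\mathcal F})=\frac{\hat{\mathcal F}^p_d\cap\ker d_1\cap\ker d_2}{\hat{\mathcal F}^p_d\cap\operatorname{Im}(d_1d_2)}.$$ *)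

(* Defs.v *)
From HB Require Import structures.
From mathcomp Require Import all_boot all_order all_algebra.
From mathcomp Require Import finmap multiset.
From mathcomp Require Import all_classical all_reals topology normedtype derive.
Import Order.TTheory GRing.Theory Num.Theory.
Import numFieldNormedType.Exports.

Set Implicit Arguments.
Unset Strict Implicit.
Unset Printing Implicit Defensive.

Local Open Scope ring_scope.
Local Open Scope classical_set_scope.

Section Smooth.
Variable R : realType.
Implicit Types f g : R -> R.

Definition smooth : {pred (R -> R)} :=
  [pred f : R -> R | `[< forall n (x : R), derivable (f^`(n)) x 1 >]].

Lemma smoothP f : reflect (forall n (x : R), derivable (f^`(n)) x 1) (f \in smooth).
Proof. exact: asboolP. Qed.

Let Cn n f := forall k, (k < n)%N -> forall x : R, derivable (f^`(k)) x 1.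

Let CnS n f : Cn n.+1 f <-> (forall x : R, derivable f x 1) /\ Cn n (f^`()).
Proof.
split=> [H|[H0 H]].
  split=> [x|k kn x]; first exact: (H 0%N).
  by rewrite -derive1Sn; apply: H.
by case=> [|k] kn x //; rewrite derive1Sn; apply: H.
Qed.

Let CnW n f : Cn n.+1 f -> Cn n f.
Proof. by move=> H k kn; apply: H; rewrite ltnW. Qed.

Let CnD n f g : Cn n f -> Cn n g -> Cn n (f + g).
Proof.
elim: n f g => [|n IH] f g; first by move=> _ _ k; rewrite ltn0.
move=> /CnS[f0 f1] /CnS[g0 g1]; apply/CnS; split.
  by move=> x; exact: (derivableD (f0 x) (g0 x)).
have -> : derive1 (f + g) = derive1 f + derive1 g.
  by apply/funext => x; rewrite derive1E (deriveD (f0 x) (g0 x)) -!derive1E.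
exact: IH.
Qed.

Let CnM n f g : Cn n f -> Cn n g -> Cn n (f * g).
Proof.
elim: n f g => [|n IH] f g fn gn; first by move=> k; rewrite ltn0.
have /CnS[f0 f1] := fn; have /CnS[g0 g1] := gn; apply/CnS; split.
  by move=> x; exact: (derivableM (f0 x) (g0 x)).
have -> : derive1 (f * g) = f * derive1 g + derive1 f * g.
  apply/funext => x; rewrite derive1E (deriveM (f0 x) (g0 x)) -!derive1E.
  by rewrite /GRing.scale/= [g x * _]mulrC.
apply: CnD; [exact: (IH _ _ (CnW fn) g1)|exact: (IH _ _ f1 (CnW gn))].
Qed.

Let smoothCn f : (forall n, Cn n f) <-> f \in smooth.
Proof.
split=> [H|/smoothP H n k _]; last exact: H.
by apply/smoothP => n; apply: (H n.+1 n (ltnSn n)).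
Qed.

Lemma smooth_cst (c : R) : cst c \in smooth.
Proof.
apply/smoothCn => n; elim: n c => [|n IH] c; first by move=> k; rewrite ltn0.
apply/CnS; split.
  by move=> x; apply: derivable_cst.
have -> : derive1 (cst c) = cst 0 :> (R -> R).
  by apply/funext => x; rewrite derive1_cst.
exact: IH.
Qed.

Lemma smooth_id : (id : R -> R) \in smooth.
Proof.
apply/smoothCn => -[|n]; first by move=> k; rewrite ltn0.
apply/CnS; split; first by move=> x; apply: derivable_id.
have -> : derive1 (id : R -> R) = cst 1.
  by apply/funext => x; rewrite derive1E derive_id.
by have /smoothCn := smooth_cst 1; apply.
Qed.

Lemma smooth_derive1 f : f \in smooth -> f^`() \in smooth.
Proof. by move=> /smoothCn H; apply/smoothCn => n; have /CnS[] := H n.+1. Qed.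

Lemma smoothD f g : f \in smooth -> g \in smooth -> f + g \in smooth.
Proof. by move=> /smoothCn ? /smoothCn ?; apply/smoothCn=> n; apply: CnD. Qed.

Lemma smoothM f g : f \in smooth -> g \in smooth -> f * g \in smooth.
Proof. by move=> /smoothCn ? /smoothCn ?; apply/smoothCn=> n; apply: CnM. Qed.

Lemma smooth_subring_closed : subring_closed smooth.
Proof.
split=> [|f g fs gs|f g]; [exact: smooth_cst| |exact: smoothM].
have -> : - g = cst (- 1) * g by apply/funext => x; rewrite !fctE mulN1r.
exact: smoothD fs (smoothM (smooth_cst _) gs).
Qed.

HB.instance Definition _ :=
  GRing.isSubringClosed.Build _ smooth smooth_subring_closed.

Record cinf := Cinf { cinf_fun :> R -> R; _ : cinf_fun \in smooth }.
HB.instance Definition _ := [isSub for cinf_fun].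
HB.instance Definition _ := [Choice of cinf by <:].
HB.instance Definition _ := [SubChoice_isSubComNzRing of cinf by <:].

Lemma cinf_smooth (f : cinf) : (f : R -> R) \in smooth.
Proof. by case: f. Qed.

Definition cinf_cst (c : R) : cinf := Cinf (smooth_cst c).
Definition cinf_id : cinf := Cinf smooth_id.
Definition cinf_derive (f : cinf) : cinf := Cinf (smooth_derive1 (cinf_smooth f)).

Lemma cinf_deriveB : {morph cinf_derive : f g / f - g}.
Proof.
move=> f g; apply: val_inj; apply/funext => x /=.
have df (h : cinf) : derivable h x 1 by case: h => h /= /smoothP /(_ 0%N x).
transitivity (derive1 f x - derive1 g x); last by [].
by rewrite !derive1E; exact: (deriveB (df f) (df g)).
Qed.

HB.instance Definition _ :=
  GRing.isZmodMorphism.Build cinf cinf cinf_derive cinf_deriveB.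

End Smooth.

(* (m, S) encodes the standard monomial
     \prod_k (u^{k+1})^{m k} * theta^{s_1} ... theta^{s_r},
   with S = {s_1 < ... < s_r}.  The exponent of the jet variable u^{k+1} is
   stored at index k, because u^0 = u is not a polynomial variable: it is the
   argument of the coefficient functions. *)
Definition monomial := ({mset nat}%mset * {fset nat})%type.

Definition stdeg (M : monomial) : nat :=
  (\sum_(k <- M.1) k.+1 + \sum_(s <- M.2) s)%N.
Definition supdeg (M : monomial) : nat := #|` M.2|.

(* theta_S * theta_T = (-1) ^+ inversions S T * theta_(S `|` T) for disjoint S
   and T, where theta_S is the increasing product of the theta^s, s in S. *)
Definition inversions (S T : {fset nat}) : nat :=
  (\sum_(a <- S) \sum_(b <- T) (b < a))%N.

(* number of elements of S that are smaller than s *)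
Definition below (s : nat) (S : {fset nat}) : nat :=
  inversions [fset s]%fset S.

Lemma belowE s S : below s S = (\sum_(b <- S) (b < s))%N.
Proof. by rewrite /below /inversions big_seq_fset1. Qed.

Lemma belowU s t S : t \notin S -> below s (t |` S)%fset = ((t < s) + below s S)%N.
Proof. by move=> tS; rewrite !belowE big_fsetU1. Qed.

Lemma belowD s t S : t \in S -> below s S = ((t < s) + below s (S `\ t)%fset)%N.
Proof. by move=> tS; rewrite !belowE (big_fsetD1 _ tS). Qed.

Lemma stdegU k (m : {mset nat}%mset) S :
  stdeg ((k +` m)%mset, S) = (k.+1 + stdeg (m, S))%N.
Proof.
rewrite /stdeg /= addnA; congr addn.
rewrite (perm_big (k :: enum_mset m)) ?big_cons//.
by apply/allP => x _ /=; rewrite !count_mem_mset mset1DE [x == k]eq_sym.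
Qed.

Lemma stdegD k (m : {mset nat}%mset) S : k \in m ->
  stdeg (m, S) = (k.+1 + stdeg ((m `\ k)%mset, S))%N.
Proof. by move=> km; rewrite -stdegU msetB1K. Qed.

Lemma stdegUth s (m : {mset nat}%mset) S : s \notin S ->
  stdeg (m, (s |` S)%fset) = (s + stdeg (m, S))%N.
Proof. by move=> sS; rewrite /stdeg /= big_fsetU1//= addnCA. Qed.

Lemma stdegDth s (m : {mset nat}%mset) S : s \in S ->
  stdeg (m, S) = (s + stdeg (m, (S `\ s)%fset))%N.
Proof. by move=> sS; rewrite -stdegUth ?fsetD11// fsetD1K. Qed.

Lemma finite_msub (m : {mset nat}%mset) :
  finite_set [set n : {mset nat}%mset | (n `<=` m)%mset].
Proof.
pose F (b : (size m).-tuple bool) : {mset nat}%mset := seq_mset (mask b m).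
apply: (@sub_finite_set _ _ (F @` setT)); last exact/finite_image/finite_finset.
move=> n /= /msubsetP nm.
have /count_subseqP[s /subseqP[b /eqP sb ->] pn] :
  forall x, (count_mem x n <= count_mem x m)%N by move=> x; rewrite !count_mem_mset.
exists (Tuple sb) => //; rewrite /F /= -[RHS]seq_mset_id.
by apply/eq_seq_msetP; rewrite perm_sym.
Qed.

Section Algebra.
Variable R : realType.

(* An element is the family of the coefficients of its standard monomials.
   There are finitely many monomials of each standard degree, so arbitrary
   families are exactly the elements of the completion. *)
Definition hatA := monomial -> cinf R.
HB.instance Definition _ := Choice.copy hatA (monomial -> cinf R).
HB.instance Definition _ := GRing.Zmodule.copy hatA (monomial -> cinf R).

(* The outer index set is finite: see finite_msub. *)
Definition amul (f g : hatA) : hatA := fun M =>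
  \sum_(m \in [set m : {mset nat}%mset | (m `<=` M.1)%mset])
    \sum_(S <- fpowerset M.2)
      (-1) ^+ inversions S (M.2 `\` S)%fset *
      (f (m, S) * g ((M.1 `\` m)%mset, (M.2 `\` S)%fset)).

Definition mono (c : cinf R) (M : monomial) : hatA :=
  fun N => if N == M then c else 0.
Definition coef (c : cinf R) : hatA := mono c (mset0, fset0).
Definition uvar (s : nat) : hatA :=
  if s is k.+1 then mono 1 ([mset k]%mset, fset0)
  else coef (cinf_id R).
Definition thvar (s : nat) : hatA := mono 1 (mset0, [fset s]%fset).

Definition pdu (s : nat) (f : hatA) : hatA := fun M =>
  if s is k.+1 then f ((k +` M.1)%mset, M.2) *+ (M.1 k).+1
  else cinf_derive (f M).
(* left derivative *)
Definition pdth (s : nat) (f : hatA) : hatA := fun M =>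
  if s \in M.2 then 0
  else (-1) ^+ below s M.2 * f (M.1, (s |` M.2)%fset).

(* The sum of a series whose s-th term has no component of standard degree
   smaller than s; this holds for every series below, and then the terms left
   out of the coefficient at M vanish (see fsumW). *)
Definition fsum (F : nat -> hatA) : hatA := fun M =>
  \sum_(s < (stdeg M).+1) F s M.

(* the total derivative *)
Definition dx (f : hatA) : hatA :=
  fsum (fun s => amul (uvar s.+1) (pdu s f) + amul (thvar s.+1) (pdth s f)).

Definition mdx (f : hatA) : hatA := - dx f.
Definition delta_u (f : hatA) : hatA := fsum (fun s => iter s mdx (pdu s f)).
Definition delta_th (f : hatA) : hatA := fsum (fun s => iter s mdx (pdth s f)).

Definition homog (p d : nat) (f : hatA) : Prop :=
  forall M, f M != 0 -> supdeg M = p /\ stdeg M = d.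

Lemma amul_mono c m0 S0 f M : amul (mono c (m0, S0)) f M =
  if (m0 `<=` M.1)%mset && (S0 `<=` M.2)%fset then
    (-1) ^+ inversions S0 (M.2 `\` S0)%fset *
      (c * f ((M.1 `\` m0)%mset, (M.2 `\` S0)%fset)) else 0.
Proof.
rewrite /amul /mono; case: ifPn => [/andP[mM SM]|nM].
  rewrite (fsbigE [:: m0])//=; first last.
  - by move=> m _; rewrite inE => /negPf mm0; rewrite big1// => S _;
       rewrite xpair_eqE mm0 mul0r mulr0.
  - by move=> m /=; rewrite inE => /eqP ->.
  rewrite big_cons big_nil ifT ?inE// addr0.
  have S0P : S0 \in fpowerset M.2 by rewrite fpowersetE.
  rewrite (big_fsetD1 _ S0P)/= eqxx big1_seq ?addr0// => S /=.
  rewrite !inE => /andP[/negPf SS0 _].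
  by rewrite xpair_eqE SS0 andbF mul0r mulr0.
rewrite fsbig1// => m /= mM; rewrite big1_seq// => S /=; rewrite fpowersetE => SM.
case: eqP => [[mm0 SS0]|_]; last by rewrite mul0r mulr0.
by move: nM; rewrite -mm0 -SS0 mM SM.
Qed.

Lemma pdthE s f m S : pdth s f (m, S) =
  if s \in S then 0 else (-1) ^+ below s S * f (m, (s |` S)%fset).
Proof. by []. Qed.

Lemma amul_u k f M : amul (uvar k.+1) f M =
  if k \in M.1 then f ((M.1 `\ k)%mset, M.2) else 0.
Proof.
rewrite amul_mono msub1set fsub0set andbT fsetD0; case: ifP => // _.
by rewrite /inversions big_seq_fset0 expr0 !mul1r.
Qed.

Lemma amul_th s f M : amul (thvar s) f M =
  if s \in M.2 then
    (-1) ^+ below s (M.2 `\ s)%fset * f (M.1, (M.2 `\ s)%fset) else 0.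
Proof.
rewrite amul_mono msub0set fsub1set /= mul1r.
have -> : (M.1 `\` mset0)%mset = M.1 by apply/msetP => x; rewrite msetE2 mset0E subn0.
by [].
Qed.

Lemma dxE f M : dx f M = \sum_(s < (stdeg M).+1)
  (amul (uvar s.+1) (pdu s f) M + amul (thvar s.+1) (pdth s f) M).
Proof. by []. Qed.

Lemma pduB s : {morph pdu s : f g / f - g}.
Proof.
move=> f g; apply/funext => M; case: s => [|s]; rewrite /pdu !fctE.
  exact: raddfB.
exact: mulrnBl.
Qed.

Lemma pdthB s : {morph pdth s : f g / f - g}.
Proof.
move=> f g; apply/funext => M; rewrite /pdth !fctE.
by case: ifP => _; rewrite ?subr0// mulrBr.
Qed.

Lemma amulBr f : {morph amul f : g h / g - h}.
Proof.
move=> g h; apply/funext => M; rewrite /amul !fctE.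
rewrite !(fsbig_finite _ _ (finite_msub M.1)) -sumrB; apply: eq_bigr => m _.
by rewrite -sumrB; apply: eq_bigr => S _; rewrite -mulrBr -mulrBr.
Qed.

HB.instance Definition _ s :=
  GRing.isZmodMorphism.Build hatA hatA (pdu s) (pduB s).
HB.instance Definition _ s :=
  GRing.isZmodMorphism.Build hatA hatA (pdth s) (pdthB s).
HB.instance Definition _ f :=
  GRing.isZmodMorphism.Build hatA hatA (amul f) (amulBr f).

Lemma dxB : {morph dx : f g / f - g}.
Proof.
move=> f g; apply/funext => M; rewrite !fctE !dxE -sumrB.
by apply: eq_bigr => s _; rewrite !raddfB !fctE opprD addrACA.
Qed.
HB.instance Definition _ := GRing.isZmodMorphism.Build hatA hatA dx dxB.

Lemma mdxB : {morph mdx : f g / f - g}.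
Proof. by move=> f g; rewrite /mdx raddfB opprB opprK addrC. Qed.
HB.instance Definition _ := GRing.isZmodMorphism.Build hatA hatA mdx mdxB.

Lemma iter_mdxB s : {morph iter s mdx : f g / f - g}.
Proof. by move=> f g; elim: s => //= s ->; rewrite raddfB. Qed.
HB.instance Definition _ s :=
  GRing.isZmodMorphism.Build hatA hatA (iter s mdx) (iter_mdxB s).

Lemma delta_uB : {morph delta_u : f g / f - g}.
Proof.
move=> f g; apply/funext => M; rewrite /delta_u /fsum !fctE -sumrB.
by apply: eq_bigr => s _; rewrite !raddfB.
Qed.

Lemma delta_thB : {morph delta_th : f g / f - g}.
Proof.
move=> f g; apply/funext => M; rewrite /delta_th /fsum !fctE -sumrB.
by apply: eq_bigr => s _; rewrite !raddfB.
Qed.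

HB.instance Definition _ := GRing.isZmodMorphism.Build hatA hatA delta_u delta_uB.
HB.instance Definition _ := GRing.isZmodMorphism.Build hatA hatA delta_th delta_thB.

Definition ordge (n : nat) (f : hatA) : Prop :=
  forall M, (stdeg M < n)%N -> f M = 0.

Lemma ordge_u s n f : ordge n f -> ordge (s.+1 + n) (amul (uvar s.+1) f).
Proof.
move=> fn [m S]; rewrite amul_u; case: ifP => //= sm; rewrite (stdegD _ sm).
by rewrite ltn_add2l => /fn.
Qed.

Lemma ordge_th s n f : ordge n f -> ordge (s + n) (amul (thvar s) f).
Proof.
move=> fn [m S]; rewrite amul_th; case: ifP => //= sm; rewrite (stdegDth _ sm).
by rewrite ltn_add2l => /fn ->; rewrite mulr0.
Qed.

Lemma ordge_pdu s n f : ordge (s + n) f -> ordge n (pdu s f).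
Proof.
move=> fn [m S] Mn; rewrite /pdu; case: s fn => [|s] fn.
  by rewrite fn// raddf0.
by rewrite fn ?mul0rn//= stdegU ltn_add2l.
Qed.

Lemma ordge_pdth s n f : ordge (s + n) f -> ordge n (pdth s f).
Proof.
move=> fn [m S] Mn; rewrite /pdth/=; case: ifPn => // sS.
by rewrite fn ?mulr0//= stdegUth// ltn_add2l.
Qed.

Lemma ordge0 f : ordge 0 f. Proof. by []. Qed.

Lemma ordge_dx n f : ordge n f -> ordge n.+1 (dx f).
Proof.
move=> fn M Mn; rewrite dxE big1// => s _.
have sn : ordge (n - s) (pdu s f) /\ ordge (n - s) (pdth s f).
  have [ns|sn] := leqP n s; first by rewrite (eqP (ns : n - s == 0)%N).
  by split; [apply: ordge_pdu|apply: ordge_pdth]; rewrite subnKC ?(ltnW sn).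
have le : (stdeg M < s.+1 + (n - s))%N.
  by rewrite addSn -maxnE ltnS (leq_trans _ (leq_maxr _ _)).
by rewrite (ordge_u sn.1)// (ordge_th sn.2)// addr0.
Qed.

Lemma ordge_iter s f : ordge s (iter s mdx f).
Proof.
elim: s => [|s IH] M Ms; first by [].
by rewrite iterS {1}/mdx fctE (ordge_dx IH Ms) oppr0.
Qed.

Lemma fsumW F M n : (forall s, ordge s (F s)) -> (stdeg M < n)%N ->
  fsum F M = \sum_(s < n) F s M.
Proof.
move=> Fs Mn; rewrite /fsum (big_ord_widen n (fun s => F s M) Mn) big_mkcond /=.
by apply: eq_bigr => s _; case: ifPn => //; rewrite -leqNgt => /Fs ->.
Qed.

Lemma dxW f M n : (stdeg M < n)%N -> dx f M = \sum_(s < n)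
  (amul (uvar s.+1) (pdu s f) M + amul (thvar s.+1) (pdth s f) M).
Proof.
move=> Mn; rewrite /dx (fsumW _ Mn) => // s N Ns.
rewrite fctE (ordge_u (@ordge0 _)) ?(ordge_th (@ordge0 _)) ?addr0//;
  by rewrite addn0 ltnW.
Qed.

Lemma pdu_ampu s k f : pdu s (amul (uvar k.+1) f) =
  amul (uvar k.+1) (pdu s f) + (if s == k.+1 then f else 0).
Proof.
apply/funext => -[m S]; rewrite fctE amul_u /=; case: s => [|s] /=.
  by rewrite amul_u addr0 /=; case: ifP => // _; rewrite raddf0.
rewrite amul_u /= eqSS in_mset1D; have [->|sk] := eqVneq s k.
  rewrite /= ?eqxx /= msetD1K; case: ifPn => [km|]; last first.
    by rewrite -mset_eq0 => /eqP ->; rewrite add0r mulr1n.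
  rewrite msetB1K// msetB1E eqxx subn1 prednK ?mset_gt0//.
  by rewrite -mulrSr.
rewrite addr0 /=; case: ifP => km; last by rewrite mul0rn.
rewrite msetB1E (negPf sk) subn0; congr (f (_, _) *+ _).
apply/msetP => x; rewrite !(mset1DE, msetB1E).
have [->|xk] := eqVneq x k; last by rewrite !subn0.
by rewrite eq_sym (negPf sk).
Qed.

Lemma pdu_amth s t f : pdu s (amul (thvar t) f) = amul (thvar t) (pdu s f).
Proof.
apply/funext => -[m S]; rewrite amul_th /=; case: s => [|s] /=.
  rewrite amul_th /=; case: ifP => [_|_]; last exact: raddf0.
  by rewrite -signr_odd; case: odd; rewrite ?expr0 ?expr1 ?mul1r ?mulN1r ?raddfN.
by rewrite amul_th /=; case: ifP => _; rewrite ?mul0rn// mulrnAr.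
Qed.

Lemma pdth_amu s k f : pdth s (amul (uvar k.+1) f) = amul (uvar k.+1) (pdth s f).
Proof.
apply/funext => -[m S]; rewrite amul_u /pdth /= amul_u /=.
by case: ifP => _; case: ifP => _ //; rewrite mulr0.
Qed.

Lemma pdth_amth s t f : pdth s (amul (thvar t) f) =
  (if s == t then f else 0) - amul (thvar t) (pdth s f).
Proof.
apply/funext => -[m S]; rewrite !fctE amul_th !pdthE amul_th /=.
have [<-{t}|st] := eqVneq s t.
  rewrite fsetU11 in_fsetD1 eqxx /=.
  have [sS|sS] := boolP (s \in S).
    rewrite fsetD1K//.
    by rewrite mulrA -exprD addnn -signr_odd odd_double expr0 mul1r subrr.
  have -> : ((s |` S) `\ s)%fset = S.
    by apply/fsetP => x; rewrite !inE; case: eqVneq => // ->; rewrite (negPf sS).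
  by rewrite mulrA -exprD addnn -signr_odd odd_double expr0 mul1r subr0.
rewrite in_fsetD1 st /= in_fset1U [t == s]eq_sym (negPf st) /= add0r.
have [sS|sS] := boolP (s \in S); first by case: ifP; rewrite ?mulr0 oppr0.
have [tS|tS] := boolP (t \in S); last by rewrite mulr0 oppr0.
have -> : ((s |` S) `\ t)%fset = (s |` (S `\ t))%fset.
  apply/fsetP => x; rewrite !inE; have [->|//] := eqVneq x s; first by rewrite st.
rewrite belowU ?in_fsetD1 ?(negPf sS) ?andbF// (belowD s tS).
rewrite !mulrA -!exprD -mulNr; congr (_ * _).
have -> : ((t < s) + below s (S `\ t)%fset + ((s < t) + below t (S `\ t)%fset) =
           (below t (S `\ t)%fset + below s (S `\ t)%fset).+1)%N.
  by case: (ltngtP s t) st => //= _ _; rewrite ?add0n ?add1n ?addSn ?addnS addnC.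
by rewrite exprS mulN1r.
Qed.

Lemma pduC s t f : pdu s (pdu t f) = pdu t (pdu s f).
Proof.
apply/funext => -[m S]; case: s t => [|s] [|t] //=; rewrite ?raddfMn//.
rewrite -!mulrnA !mset1DE msetDCA; congr (_ *+ _).
have [->|//] := eqVneq s t; by rewrite mulnC.
Qed.

Lemma pdu_pdth s t f : pdu s (pdth t f) = pdth t (pdu s f).
Proof.
apply/funext => -[m S]; case: s => [|s] /=; rewrite /pdth /=; case: ifP => _.
- exact: raddf0.
- by rewrite -signr_odd; case: odd; rewrite ?expr0 ?expr1 ?mul1r ?mulN1r ?raddfN.
- exact: mul0rn.
- by rewrite mulrnAr.
Qed.

Lemma pdthC s t f : pdth s (pdth t f) = - pdth t (pdth s f).
Proof.
apply/funext => -[m S]; rewrite fctE !pdthE.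
rewrite !in_fset1U.
have [->|st] /= := eqVneq s t; first by rewrite !mulr0; case: ifP; rewrite oppr0.
have [sS|sS] := boolP (s \in S); have [tS|tS] := boolP (t \in S);
  rewrite ?mulr0 ?oppr0//.
rewrite !belowU// !mulrA -!exprD -mulNr fsetUCA; congr (_ * _).
have -> : (below s S + ((s < t) + below t S) =
           (below s S + below t S) + (s < t))%N by rewrite addnCA addnC.
have -> : (below t S + ((t < s) + below s S) =
           (below s S + below t S) + (t < s))%N by rewrite addnCA addnC [(below t S + _)%N]addnC.
by case: (ltngtP s t) st => //= _ _; rewrite addn0 addn1 exprS mulN1r ?opprK.
Qed.

Definition shiftd (pd : nat -> hatA -> hatA) (s : nat) (f : hatA) : hatA :=
  if s is t.+1 then pd t f else 0.

Lemma sum_pd_gen (pd : nat -> hatA -> hatA) s f M n : (s < n)%N ->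
  \sum_(k < n) (if s == k.+1 then pd k f else 0) M = shiftd pd s f M.
Proof.
case: s => [|s] sn /=; first by rewrite big1.
rewrite (bigD1 (Ordinal (ltnW sn))) //= eqxx big1 ?addr0// => k ks.
rewrite eqSS ifN// eq_sym; apply: contra ks => /eqP ks; exact/eqP/val_inj.
Qed.

Lemma pdu_dx s f : pdu s (dx f) = dx (pdu s f) + shiftd pdu s f.
Proof.
apply/funext => -[m S]; set M := (m, S).
pose n := (s.+1 + stdeg M).+1.
have nM : (stdeg M < n)%N by rewrite /n ltnS leq_addl.
have sn : (s < n)%N by rewrite /n ltnS addSn leqW ?leq_addr.
transitivity (\sum_(k < n) pdu s (amul (uvar k.+1) (pdu k f) +
                amul (thvar k.+1) (pdth k f)) M).
  case: s @n nM sn => [|s] n nM sn.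
    by rewrite /= (dxW f nM) raddf_sum.
  rewrite /= (@dxW _ _ n); first by rewrite -sumrMnl.
  by rewrite stdegU /n ltnS addSn leqW.
rewrite fctE (dxW _ nM) -(sum_pd_gen pdu f M sn) -big_split /=; apply: eq_bigr => k _.
rewrite raddfD /= pdu_ampu pdu_amth !fctE pduC pdu_pdth addrAC; congr (_ + _ + _).
Qed.

Lemma pdth_dx s f : pdth s (dx f) = dx (pdth s f) + shiftd pdth s f.
Proof.
apply/funext => -[m S]; set M := (m, S).
pose n := (s.+1 + stdeg M).+1.
have nM : (stdeg M < n)%N by rewrite /n ltnS leq_addl.
have sn : (s < n)%N by rewrite /n ltnS addSn leqW ?leq_addr.
transitivity (\sum_(k < n) pdth s (amul (uvar k.+1) (pdu k f) +
                amul (thvar k.+1) (pdth k f)) M).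
  rewrite /pdth /=; case: ifPn => sS; first by rewrite big1.
  rewrite (@dxW _ _ n) ?mulr_sumr// stdegUth//.
rewrite fctE (dxW _ nM) -(sum_pd_gen pdth f M sn) -big_split /=; apply: eq_bigr => k _.
rewrite raddfD /= pdth_amu pdth_amth !fctE -pdu_pdth pdthC raddfN fctE opprK.
by rewrite -addrA [X in _ + X]addrC; case: ifP.
Qed.

Lemma fsum_telescope (pd : nat -> hatA -> hatA) f :
  (forall s, pd s (dx f) = dx (pd s f) + shiftd pd s f) ->
  fsum (fun s => iter s mdx (pd s (dx f))) = 0.
Proof.
move=> H; apply/funext => M; rewrite /fsum.
have E n : \sum_(s < n.+1) iter s mdx (pd s (dx f)) M =
    - iter n.+1 mdx (pd n f) M.
  elim: n => [|n IH].
    by rewrite big_ord1 /= H addr0 /mdx !fctE opprK.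
  have It g : iter n.+1 mdx (dx g) = - iter n.+2 mdx g.
    rewrite [iter n.+2 _ _]iterSr [mdx g]/(- dx g).
    by rewrite (raddfN (iter n.+1 mdx)) opprK.
  transitivity (- iter n.+1 mdx (pd n f) M + iter n.+1 mdx (pd n.+1 (dx f)) M).
    by rewrite -IH big_ord_recr.
  have iterD g h : iter n.+1 mdx (g + h) = iter n.+1 mdx g + iter n.+1 mdx h.
    exact: raddfD.
  rewrite H iterD It [shiftd _ _ _]/=.
  by rewrite !fctE addrCA addNr addr0.
by rewrite E (@ordge_iter _ _ _ (ltnSn _)) oppr0.
Qed.

Lemma delta_u_dx f : delta_u (dx f) = 0.
Proof. by apply: fsum_telescope => s; exact: pdu_dx. Qed.

Lemma delta_th_dx f : delta_th (dx f) = 0.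
Proof. by apply: fsum_telescope => s; exact: pdth_dx. Qed.

(* \hat F = \hat A / dx \hat A, with projection intF. *)
Definition exactA : {pred hatA} := [pred f | `[< exists g, f = dx g >]].

Lemma exactA_zmod_closed : zmod_closed exactA.
Proof.
split=> [|f g /asboolP[f' ->] /asboolP[g' ->]]; apply/asboolP.
  by exists 0; rewrite raddf0.
by exists (f' - g'); rewrite raddfB.
Qed.
HB.instance Definition _ := GRing.isZmodClosed.Build hatA exactA exactA_zmod_closed.

Definition hatF := {ideal_quot exactA}.
HB.instance Definition _ := GRing.Zmodule.copy hatF {ideal_quot exactA}.

Definition intF (f : hatA) : hatF := \pi_({ideal_quot exactA})%qT f.
Definition repF (P : hatF) : hatA := repr (P : {ideal_quot exactA}).

Lemma intFB : {morph intF : f g / f - g}.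
Proof. by move=> f g; rewrite /intF !piE. Qed.
HB.instance Definition _ := GRing.isZmodMorphism.Build hatA hatF intF intFB.

Lemma repFK P : intF (repF P) = P.
Proof. exact: reprK. Qed.

Lemma intF_eq f g : intF f = intF g <-> exists h, f - g = dx h.
Proof.
rewrite /intF; split=> [/eqP|fg].
  by rewrite -Quotient.idealrBE => /asboolP.
by apply/eqP; rewrite -Quotient.idealrBE; apply/asboolP.
Qed.

(* The variational derivatives on the quotient do not depend on the
   representative: see var_uE and var_thE. *)
Definition var_u (P : hatF) : hatA := delta_u (repF P).
Definition var_th (P : hatF) : hatA := delta_th (repF P).

Lemma var_uE f : var_u (intF f) = delta_u f.
Proof.
have /intF_eq[h e] := repFK (intF f).
by apply/eqP; rewrite /var_u -subr_eq0 -delta_uB e delta_u_dx.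
Qed.

Lemma var_thE f : var_th (intF f) = delta_th f.
Proof.
have /intF_eq[h e] := repFK (intF f).
by apply/eqP; rewrite /var_th -subr_eq0 -delta_thB e delta_th_dx.
Qed.

Lemma var_uB : {morph var_u : P Q / P - Q}.
Proof. by move=> P Q; rewrite -[P]repFK -[Q]repFK -intFB !var_uE delta_uB. Qed.
Lemma var_thB : {morph var_th : P Q / P - Q}.
Proof. by move=> P Q; rewrite -[P]repFK -[Q]repFK -intFB !var_thE delta_thB. Qed.

HB.instance Definition _ := GRing.isZmodMorphism.Build hatF hatA var_u var_uB.
HB.instance Definition _ := GRing.isZmodMorphism.Build hatF hatA var_th var_thB.

(* the Schouten bracket [P, Q] for P of super degree p *)
Definition schouten (p : nat) (P Q : hatF) : hatF :=
  intF (amul (var_th P) (var_u Q) + amul (var_u P) (var_th Q) *~ (-1) ^+ p).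

Lemma schoutenB p P : {morph schouten p P : Q1 Q2 / Q1 - Q2}.
Proof.
move=> Q1 Q2; rewrite /schouten -intFB; congr intF.
by rewrite var_uB var_thB !amulBr mulrzBl opprD addrACA.
Qed.
HB.instance Definition _ p P :=
  GRing.isZmodMorphism.Build hatF hatF (schouten p P) (schoutenB p P).

Definition bivector1 : hatF :=
  intF (amul (coef (cinf_cst 2^-1)) (amul (thvar 0) (thvar 1))).
Definition bivector2 : hatF :=
  intF (amul (coef (cinf_cst 2^-1))
         (amul (uvar 0) (amul (thvar 0) (thvar 1)))).

Definition d1 (Q : hatF) : hatF := schouten 2 bivector1 Q.
Definition d2 (Q : hatF) : hatF := schouten 2 bivector2 Q.
HB.instance Definition _ := GRing.isZmodMorphism.Build hatF hatF d1 (schoutenB 2 bivector1).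
HB.instance Definition _ := GRing.isZmodMorphism.Build hatF hatF d2 (schoutenB 2 bivector2).

Definition homogF p d : {pred hatF} :=
  [pred P | `[< exists2 f, homog p d f & P = intF f >]].

Lemma homogF_zmod_closed p d : zmod_closed (homogF p d).
Proof.
split=> [|P Q /asboolP[f fh ->] /asboolP[g gh ->]]; apply/asboolP.
  by exists 0; [move=> M; rewrite eqxx|rewrite raddf0].
exists (f - g); last by rewrite raddfB.
move=> M; rewrite fctE; have [->|/fh//] := eqVneq (f M) 0.
by rewrite sub0r oppr_eq0 => /gh.
Qed.
HB.instance Definition _ p d :=
  GRing.isZmodClosed.Build hatF (homogF p d) (homogF_zmod_closed p d).

(* \hat F^p_d \cap ker d1 \cap ker d2, and \hat F^p_d \cap Im (d1 d2) inside it *)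
Definition cocycles p d : {pred hatF} :=
  [pred P | [&& P \in homogF p d, d1 P == 0 & d2 P == 0]].

Lemma cocyclesE p d P : (P \in cocycles p d) =
  [&& P \in homogF p d, d1 P == 0 & d2 P == 0].
Proof. by []. Qed.

Lemma cocycles_zmod_closed p d : zmod_closed (cocycles p d).
Proof.
split=> [|P Q]; rewrite !cocyclesE; first by rewrite rpred0 !raddf0 eqxx.
move=> /and3P[hP /eqP P1 /eqP P2] /and3P[hQ /eqP Q1 /eqP Q2].
by rewrite rpredB// !raddfB /= P1 P2 Q1 Q2 subrr eqxx.
Qed.
HB.instance Definition _ p d :=
  GRing.isZmodClosed.Build hatF (cocycles p d) (cocycles_zmod_closed p d).

Record cocycle p d := Cocycle { cocycle_val :> hatF; _ : cocycle_val \in cocycles p d }.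
HB.instance Definition _ p d := [isSub for @cocycle_val p d].
HB.instance Definition _ p d := [Choice of cocycle p d by <:].
HB.instance Definition _ p d := [SubChoice_isSubZmodule of cocycle p d by <:].

Definition coboundaries p d : {pred cocycle p d} :=
  [pred P | `[< exists Q : hatF, val P = d1 (d2 Q) >]].

Arguments coboundaries : clear implicits.

Lemma coboundaries_zmod_closed p d : zmod_closed (coboundaries p d).
Proof.
split=> [|P Q /asboolP[f Pf] /asboolP[g Qg]]; apply/asboolP.
  by exists 0; rewrite !raddf0.
exists (f - g); transitivity (val P - val Q); first exact: raddfB.
by rewrite Pf Qg !raddfB.
Qed.
HB.instance Definition _ p d :=
  GRing.isZmodClosed.Build (cocycle p d) (coboundaries p d) (coboundaries_zmod_closed p d).

Definition BH p d := {ideal_quot (coboundaries p d)}.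
HB.instance Definition _ p d := GRing.Zmodule.copy (BH p d) {ideal_quot (coboundaries p d)}.

End Algebra.

Arguments exactA : clear implicits.
Arguments homogF : clear implicits.
Arguments cocycles : clear implicits.
Arguments coboundaries : clear implicits.

(* Main.v *)
Require Import Defs.
From HB Require Import structures.
From mathcomp Require Import all_boot all_order all_algebra.
From mathcomp Require Import finmap multiset.
From mathcomp Require Import all_classical all_reals topology normedtype derive.
From mathcomp Require Import ring zify.
Import Order.TTheory GRing.Theory Num.Theory.
Import numFieldNormedType.Exports.
Set Implicit Arguments.
Unset Strict Implicit.
Unset Printing Implicit Defensive.
Local Open Scope ring_scope.

(** On representatives the two differentials act through odd derivations
    D1 and D2 of hatA; here DD2 = 2 D2 avoids denominators.  Both commute with
    dx, and dx is injective in positive standard degree ([dx_inj]), so the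
    theorem reduces to two vanishing statements on hatA.

    First, D1 is acyclic in standard degree at least 2 ([D1_acyclic]).  Call
    the number of factors u^s, s >= 1, of a monomial its jet number.  Then
    D1 = dR + dbase, where dR = sum_(s >= 1) theta^(s+1) d/du^s is a de Rham
    differential with the usual Poincare homotopy ([invdR_dR]) and lowers the
    jet number by one, while dbase = theta^1 d/du preserves it.  Hence a cocycle
    is killed component by component, and no primitive in u is ever taken.

    Second, the pencil DD2 - lambda D1 is acyclic on hatA[lambda] in bidegree
    (p, d), d >= 2, as soon as d - p + 2m > 0 for the jet number m of every
    monomial of that bidegree ([pencil_acyclic]).  With v = 2u - lambda one has
      DD2 - lambda D1 = v dR + (v dbase + del) + dup,
    the three parts changing the jet number by -1, 0, 1.  The component of lowest
    jet number m of a cocycle is dR-closed because v is not a zero divisor.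
    Divide it by v: it is zeta + v w, with zeta its value at lambda = 2u, and w
    is dR-closed, so v w can be removed.  The next component of the cocycle
    equation, evaluated at lambda = 2u, then says del zeta = 0.  The contraction
    h = d/dtheta^1 anticommutes with dR and satisfies h del + del h = d - p + 2m
    ([h_del]); this number is positive, so zeta is del of a multiple of h zeta
    and can be removed too.  The jet number of the lowest component grows and is
    at most d, so the procedure stops.  The condition holds for p = 3, 4 and
    d >= 4 ([eulpos_ge4]): the only problematic case p = d = 4, m = 0 would need
    four distinct theta^s of total degree 4.

    Finally, let f represent a class of bidegree (3, d) killed by both
    differentials: D1 f = dx g1 and DD2 f = dx g2.  Then g2 - lambda g1 is a
    cocycle of the pencil in bidegree (4, d), hence the image of some y, and
    f - dx y is a cocycle in bidegree (3, d), hence the image of some l.  Modulo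
    dx, f is therefore the pencil applied to a polynomial l in lambda, and
    D1-acyclicity lowers the degree of l until f = DD2 D1 w = - D1 DD2 w
    ([cocycle_coboundary]).

    All the relations between operators that this uses are relations between
    derivations, and are checked on generators thanks to [rigid]. *)

(** * Multiplication by functions and generators *)

(** The index is that of the multisets of exponents: [umul k] is multiplication
    by u^(k+1), while u itself acts through [cmul]. *)
HB.lock Definition umul (R : realType) (k : nat) : hatA R -> hatA R := amul (uvar R k.+1).
HB.lock Definition tmul (R : realType) (s : nat) : hatA R -> hatA R := amul (thvar R s).
Arguments umul {R} k.
Arguments tmul {R} s.

Section Generators.
Variable R : realType.
Local Notation hA := (hatA R).
Implicit Types (f g : hA) (c : cinf R) (M : monomial) (T : hA -> hA).

Definition cmul c f : hA := fun M => c * f M.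
Definition one : hA := mono 1 (mset0, fset0).

Lemma umulB k : {morph @umul R k : f g / f - g}.
Proof. by rewrite umul.unlock; exact: amulBr. Qed.
Lemma tmulB s : {morph @tmul R s : f g / f - g}.
Proof. by rewrite tmul.unlock; exact: amulBr. Qed.
HB.instance Definition _ k := GRing.isZmodMorphism.Build hA hA (umul k) (umulB k).
HB.instance Definition _ s := GRing.isZmodMorphism.Build hA hA (tmul s) (tmulB s).

Lemma umulE k f M : umul k f M =
  if k \in M.1 then f ((M.1 `\ k)%mset, M.2) else 0.
Proof. by rewrite umul.unlock amul_u. Qed.

Lemma tmulE s f M : tmul s f M =
  if s \in M.2 then
    (-1) ^+ below s (M.2 `\ s)%fset * f (M.1, (M.2 `\ s)%fset) else 0.
Proof. by rewrite tmul.unlock amul_th. Qed.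

Lemma cmulB c : {morph cmul c : f g / f - g}.
Proof. by move=> f g; apply/funext => M; rewrite /cmul !fctE mulrBr. Qed.
HB.instance Definition _ c :=
  GRing.isZmodMorphism.Build hA hA (cmul c) (cmulB c).

Lemma cinf_deriveM c c' :
  cinf_derive (c * c') = cinf_derive c * c' + c * cinf_derive c'.
Proof.
apply: val_inj; apply/funext => x /=.
have df (h : cinf R) : derivable h x 1 by case: h => h /= /smoothP /(_ 0%N x).
transitivity (derive1 c x * c' x + c x * derive1 c' x); last by [].
rewrite !derive1E; transitivity ('D_1 (cinf_fun c * cinf_fun c') x); first by [].
by rewrite (deriveM (df c) (df c')) /GRing.scale /= addrC [X in X + _]mulrC.
Qed.

Lemma cinf_derive_cst (r : R) : cinf_derive (cinf_cst r) = 0.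
Proof. by apply: val_inj; apply/funext => x /=; rewrite derive1_cst. Qed.

Lemma cinf_derive_id : cinf_derive (cinf_id R) = 1.
Proof. by apply: val_inj; apply/funext => x /=; rewrite derive1E derive_id. Qed.

Lemma cinf_cstE (n : nat) : cinf_cst (n%:R : R) = n%:R.
Proof.
elim: n => [|n IH]; first by apply: val_inj.
by rewrite -!natr1 -IH; apply: val_inj.
Qed.

Lemma cinf_natV (n : nat) : (0 < n)%N -> cinf_cst (n%:R^-1 : R) * n%:R = 1.
Proof.
move=> n0; rewrite -cinf_cstE; apply: val_inj; apply/funext => x /=.
by apply: mulVf; rewrite pnatr_eq0 -lt0n.
Qed.

Lemma cmul_u c k f : umul k (cmul c f) = cmul c (umul k f).
Proof.
by apply/funext => M; rewrite /cmul !umulE; case: ifP; rewrite ?mulr0.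
Qed.

Lemma cmul_t c s f : tmul s (cmul c f) = cmul c (tmul s f).
Proof.
by apply/funext => M; rewrite /cmul !tmulE; case: ifP; rewrite ?mulr0 1?mulrCA.
Qed.

Lemma cmulA c c' f : cmul c (cmul c' f) = cmul (c * c') f.
Proof. by apply/funext => M; rewrite /cmul mulrA. Qed.

Lemma cmul1 f : cmul 1 f = f.
Proof. by apply/funext => M; rewrite /cmul mul1r. Qed.

Lemma u_uC k l f : umul k (umul l f) = umul l (umul k f).
Proof.
apply/funext => -[m S]; rewrite !umulE /=.
have [->//|kl] := eqVneq k l.
rewrite !in_msetB1 (negPf kl) eq_sym (negPf kl) /=.
case: (k \in m); case: (l \in m) => //.
by congr (f (_, _)); apply/msetP => x; rewrite !msetB1E subnAC.
Qed.

Lemma t_tC s t f : tmul s (tmul t f) = - tmul t (tmul s f).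
Proof.
apply/funext => -[m S]; rewrite fctE !tmulE /=.
have [<-{t}|st] := eqVneq s t.
  by rewrite in_fsetD1 eqxx /= mulr0; case: ifP; rewrite oppr0.
rewrite !in_fsetD1 [t == s]eq_sym st /=.
have [sS|sS] := boolP (s \in S); have [tS|tS] := boolP (t \in S);
  rewrite ?mulr0 ?oppr0//.
have -> : ((S `\ t) `\ s)%fset = ((S `\ s) `\ t)%fset.
  by apply/fsetP => x; rewrite !inE andbCA.
have tSs : t \in (S `\ s)%fset by rewrite in_fsetD1 eq_sym st.
have sSt : s \in (S `\ t)%fset by rewrite in_fsetD1 st.
rewrite (belowD s tSs) (belowD t sSt).
have -> : ((S `\ t) `\ s)%fset = ((S `\ s) `\ t)%fset.
  by apply/fsetP => x; rewrite !inE andbCA.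
rewrite !mulrA -!exprD -mulNr; congr (_ * _).
set a := below s _; set b := below t _.
case: (ltngtP s t) st => //= _ _; rewrite ?add0n ?add1n ?addSn ?addnS exprS;
  by rewrite mulN1r ?opprK addnC.
Qed.

Lemma t_tt s f : tmul s (tmul s f) = 0.
Proof.
apply/funext => -[m S]; rewrite !tmulE /= in_fsetD1 eqxx /= mulr0.
by case: ifP.
Qed.

Lemma t_u s k f : tmul s (umul k f) = umul k (tmul s f).
Proof.
apply/funext => -[m S]; rewrite !tmulE !umulE !tmulE /=.
by case: ifP => _; case: ifP => _ //; rewrite mulr0.
Qed.

Lemma pdu0_cmul c f : pdu 0 (cmul c f) = cmul (cinf_derive c) f + cmul c (pdu 0 f).
Proof. by apply/funext => M; rewrite fctE /cmul /pdu cinf_deriveM. Qed.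

Lemma pduS_cmul c k f : pdu k.+1 (cmul c f) = cmul c (pdu k.+1 f).
Proof. by apply/funext => M; rewrite /cmul /pdu mulrnAr. Qed.

Lemma pdth_cmul c s f : pdth s (cmul c f) = cmul c (pdth s f).
Proof. by apply/funext => M; rewrite /cmul /pdth; case: ifP; rewrite ?mulr0 1?mulrCA. Qed.

Lemma pdu_one s : pdu s one = 0.
Proof.
apply/funext => -[m S]; rewrite /pdu /one /mono; case: s => [|s] /=.
  case: ifP => _; last exact: raddf0.
  by apply: val_inj; apply/funext => x /=; rewrite derive1_cst.
rewrite xpair_eqE ifF ?mul0rn//; apply/negP => /andP[/eqP/msetP /(_ s)].
by rewrite mset1DE eqxx mset0E.
Qed.

Lemma pdth_one s : pdth s one = 0.
Proof.
apply/funext => -[m S]; rewrite /pdth /one /mono; case: ifP => //= sS.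
rewrite xpair_eqE ifF ?mulr0//; apply/negP => /andP[_ /eqP/fsetP /(_ s)].
by rewrite fsetU11 inE.
Qed.

Lemma pdu_umul s k f :
  pdu s (umul k f) = umul k (pdu s f) + (if s == k.+1 then f else 0).
Proof. by rewrite umul.unlock; exact: pdu_ampu. Qed.

Lemma pdu_tmul s t f : pdu s (tmul t f) = tmul t (pdu s f).
Proof. by rewrite tmul.unlock; exact: pdu_amth. Qed.

Lemma pdth_umul s k f : pdth s (umul k f) = umul k (pdth s f).
Proof. by rewrite umul.unlock; exact: pdth_amu. Qed.

Lemma pdth_tmul s t f :
  pdth s (tmul t f) = (if s == t then f else 0) - tmul t (pdth s f).
Proof. by rewrite tmul.unlock; exact: pdth_amth. Qed.

End Generators.

(** * Gradations *)

Section Weights.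
Variable R : realType.
Local Notation hA := (hatA R).
Implicit Types (f g : hA) (c : cinf R) (M : monomial) (T : hA -> hA).
Implicit Types (a b : nat -> int).

(** Every gradation below is an additive weight: a k is the weight of u^(k+1)
    and b s that of theta^s. *)
Definition wt a b M : int := \sum_(k <- M.1) a k + \sum_(s <- M.2) b s.

Lemma wtU a b k (m : {mset nat}%mset) S :
  wt a b ((k +` m)%mset, S) = a k + wt a b (m, S).
Proof.
rewrite /wt /= addrA; congr (_ + _).
rewrite (perm_big (k :: enum_mset m)) ?big_cons//.
by apply/allP => x _ /=; rewrite !count_mem_mset mset1DE [x == k]eq_sym.
Qed.

Lemma wtD a b k (m : {mset nat}%mset) S : k \in m ->
  wt a b (m, S) = a k + wt a b ((m `\ k)%mset, S).
Proof. by move=> km; rewrite -wtU msetB1K. Qed.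

Lemma wtUth a b s (m : {mset nat}%mset) S : s \notin S ->
  wt a b (m, (s |` S)%fset) = b s + wt a b (m, S).
Proof. by move=> sS; rewrite /wt /= big_fsetU1//= addrCA. Qed.

Lemma wtDth a b s (m : {mset nat}%mset) S : s \in S ->
  wt a b (m, S) = b s + wt a b (m, (S `\ s)%fset).
Proof. by move=> sS; rewrite -wtUth ?fsetD11// fsetD1K. Qed.

Lemma wt_supdeg M : wt (fun=> 0) (fun=> 1) M = (supdeg M)%:Z.
Proof.
by rewrite /wt big1// add0r /supdeg big_const_seq count_predT iter_addr_0 natz.
Qed.

Definition proj a b (j : int) f : hA := fun M => if wt a b M == j then f M else 0.

Lemma projB a b j : {morph proj a b j : f g / f - g}.
Proof.
by move=> f g; apply/funext => M; rewrite /proj !fctE; case: ifP; rewrite ?subr0.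
Qed.
HB.instance Definition _ a b j :=
  GRing.isZmodMorphism.Build hA hA (proj a b j) (projB a b j).

Lemma proj_proj a b i j f :
  proj a b i (proj a b j f) = if i == j then proj a b j f else 0.
Proof.
apply/funext => M; rewrite /proj; have [<-|wi] := eqVneq (wt a b M) i.
  by case: ifP => // ->.
by case: (eqVneq i j) => // <-; rewrite (negPf wi).
Qed.

Lemma projC a b a' b' i j f :
  proj a b i (proj a' b' j f) = proj a' b' j (proj a b i f).
Proof. by apply/funext => M; rewrite /proj; case: ifP => //; case: ifP. Qed.

Lemma proj_ext f g a b : (forall j, proj a b j f = proj a b j g) -> f = g.
Proof.
move=> H; apply/funext => M; have := H (wt a b M).
by move=> /(congr1 (fun h : hA => h M)); rewrite /proj eqxx.
Qed.

(** T raises the weight by r.  The formulation through projections makes sense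
    for all elements of the completion, homogeneous or not. *)
Definition wshift a b (r : int) T := forall (j : int) f, proj a b (j + r) (T f) = T (proj a b j f).

Lemma wshift_proj0 a b T : wshift a b 0 T ->
  forall j f, proj a b j (T f) = T (proj a b j f).
Proof. by move=> H j f; rewrite -{1}[j]addr0 H. Qed.

Lemma wshift_comp a b r r' T T' :
  wshift a b r T -> wshift a b r' T' -> wshift a b (r' + r) (T \o T').
Proof. by move=> H H' j f; rewrite addrA H H'. Qed.

Lemma wshift_id a b : wshift a b 0 id.
Proof. by move=> j f; rewrite addr0. Qed.

Lemma wshift0 a b r : wshift a b r (fun=> 0).
Proof. by move=> j f; rewrite raddf0. Qed.

Lemma wshiftD a b r T T' :
  wshift a b r T -> wshift a b r T' -> wshift a b r (fun f => T f + T' f).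
Proof. by move=> H H' j f; rewrite raddfD /= H H'. Qed.

Lemma wshiftN a b r T : wshift a b r T -> wshift a b r (fun f => - T f).
Proof. by move=> H j f; rewrite raddfN /= H. Qed.

Lemma wshift_cmul a b c : wshift a b 0 (cmul c).
Proof.
by move=> j f; apply/funext => M; rewrite addr0 /proj /cmul; case: ifP; rewrite ?mulr0.
Qed.

Lemma wshift_umul a b k : wshift a b (a k) (@umul R k).
Proof.
move=> j f; apply/funext => -[m S]; rewrite /proj !umulE /=.
have [km|km] := boolP (k \in m); last by case: ifP.
by rewrite (wtD _ _ _ km) [a k + _]addrC (inj_eq (addIr _)).
Qed.

Lemma wshift_tmul a b s : wshift a b (b s) (@tmul R s).
Proof.
move=> j f; apply/funext => -[m S]; rewrite /proj !tmulE /=.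
have [sS|sS] := boolP (s \in S); last by case: ifP.
rewrite (wtDth _ _ _ sS) [b s + _]addrC (inj_eq (addIr _)).
by case: ifP; rewrite ?mulr0.
Qed.

Lemma wshift_pdu0 a b : wshift a b 0 (@pdu R 0).
Proof.
move=> j f; apply/funext => M; rewrite addr0 /proj /pdu.
by case: ifP => _; rewrite ?raddf0.
Qed.

Lemma wshift_pduS a b k : wshift a b (- a k) (@pdu R k.+1).
Proof.
move=> j f; apply/funext => -[m S]; rewrite /proj /pdu /= wtU.
by rewrite -(inj_eq (addIr (a k))) subrK addrC; case: ifP; rewrite ?mul0rn.
Qed.

Lemma wshift_pdth a b s : wshift a b (- b s) (@pdth R s).
Proof.
move=> j f; apply/funext => -[m S]; rewrite /proj /pdth /=.
have [sS|sS] := boolP (s \in S); first by case: ifP.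
rewrite wtUth// -(inj_eq (addIr (b s))) subrK addrC.
by case: ifP; rewrite ?mulr0.
Qed.

Definition diag (phi : int -> cinf R) a b f : hA := fun M => phi (wt a b M) * f M.

Lemma diagB phi a b : {morph diag phi a b : f g / f - g}.
Proof. by move=> f g; apply/funext => M; rewrite /diag !fctE mulrBr. Qed.
HB.instance Definition _ phi a b :=
  GRing.isZmodMorphism.Build hA hA (diag phi a b) (diagB phi a b).

Lemma diag_proj phi a b j f : diag phi a b (proj a b j f) = cmul (phi j) (proj a b j f).
Proof.
by apply/funext => M; rewrite /diag /proj /cmul; case: ifP => [/eqP ->//|]; rewrite !mulr0.
Qed.

Lemma wshift_diag phi a b a' b' : wshift a b 0 (diag phi a' b').
Proof.
by move=> j f; apply/funext => M; rewrite addr0 /proj /diag; case: ifP; rewrite ?mulr0.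
Qed.

(** An operator of weight 0 preserves the eigenspaces of [diag phi a b]. *)
Lemma diag_comm phi a b T : wshift a b 0 T ->
  (forall (c : cinf R) f, T (cmul c f) = cmul c (T f)) ->
  forall f, T (diag phi a b f) = diag phi a b (T f).
Proof.
move=> Ts Tc f; apply: (@proj_ext _ _ a b) => j.
rewrite (wshift_proj0 (wshift_diag _ _ _ _ _)) (wshift_proj0 Ts).
rewrite (wshift_proj0 (wshift_diag _ _ _ _ _)) diag_proj Tc.
by rewrite -(wshift_proj0 Ts) diag_proj.
Qed.

End Weights.

(** * Rigidity and locally finite sums *)

Section Derivations.
Variable R : realType.
Local Notation hA := (hatA R).
Implicit Types (f g : hA) (c : cinf R) (M : monomial) (T D E : hA -> hA).
Implicit Types (a b : nat -> int) (F : nat -> hA) (X Y : nat -> hA -> hA).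

Definition std_u (k : nat) : int := k.+1%:Z.
Definition std_th (s : nat) : int := s%:Z.

Lemma wt_stdeg M : wt std_u std_th M = (stdeg M)%:Z.
Proof. by rewrite /wt /stdeg PoszD !(raddf_sum Posz). Qed.

Lemma proj_stdeg j f M : proj std_u std_th j f M = if (stdeg M)%:Z == j then f M else 0.
Proof. by rewrite /proj wt_stdeg. Qed.

Lemma sum_count (s : seq nat) (n : nat) (F : nat -> nat) :
  all (fun x => x < n)%N s ->
  (\sum_(x <- s) F x = \sum_(k < n) count_mem (k : nat) s * F k)%N.
Proof.
elim: s => [_|x s IH /= /andP[xn sn]]; first by rewrite big_nil big1.
rewrite big_cons IH// (bigD1 (Ordinal xn))//= [in RHS](bigD1 (Ordinal xn))//=.
rewrite eqxx mulnDl mul1n addnA; congr addn; apply: eq_bigr => i ix.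
by rewrite (_ : x == i = false) ?add0n//; apply/negbTE; apply: contra ix => /eqP e;
  apply/eqP/val_inj.
Qed.

Lemma umul_pdu k f M : umul k (pdu k.+1 f) M = f M *+ M.1 k.
Proof.
case: M => m S; rewrite umulE /=; case: ifPn => [km|]; last first.
  by rewrite -mset_eq0 => /eqP ->.
by rewrite msetB1K// msetB1E eqxx subn1 prednK ?mset_gt0.
Qed.

Lemma tmul_pdth s f M : tmul s (pdth s f) M = f M *+ (s \in M.2).
Proof.
case: M => m S; rewrite tmulE /=; case: ifPn => // sS.
rewrite pdthE in_fsetD1 eqxx /= fsetD1K// mulrA -exprD addnn.
by rewrite -signr_odd odd_double expr0 mul1r.
Qed.

Lemma le_sum_seq (s : seq nat) (F : nat -> nat) x :
  x \in s -> (F x <= \sum_(y <- s) F y)%N.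
Proof. by move=> xs; rewrite (big_rem x xs) leq_addr. Qed.

(** Every positive k contributes through u^k, stored at index k - 1, and
    through theta^k; theta^0 contributes nothing. *)
Lemma stdegE (m : {mset nat}%mset) (S : {fset nat}) :
  (stdeg (m, S) = \sum_(k < stdeg (m, S)) (m k * k.+1 + (k.+1 \in S) * k.+1))%N.
Proof.
rewrite big_split {1}/stdeg /=; congr addn.
  rewrite (@sum_count _ (stdeg (m, S)) succn); last first.
    apply/allP => x xm; apply: leq_trans (leq_addr _ _).
    exact: (@le_sum_seq _ succn).
  by apply: eq_bigr => k _; rewrite count_mem_mset.
rewrite (@sum_count _ (stdeg (m, S)).+1 id); last first.
  apply/allP => x xm; rewrite ltnS; apply: leq_trans (leq_addl _ _).
  exact: (@le_sum_seq _ id).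
rewrite big_ord_recl muln0 add0n; apply: eq_bigr => k _.
by rewrite count_uniq_mem ?fset_uniq.
Qed.

Lemma cinf_mulrIn (x : cinf R) n : (0 < n)%N -> x *+ n = 0 -> x = 0.
Proof.
by move=> n0 H; rewrite -[x]mul1r -(cinf_natV R n0) -mulrA mulr_natl H mulr0.
Qed.

Lemma hatA_mulrnE f n M : (f *+ n) M = f M *+ n.
Proof. by elim: n => // n IH; rewrite !mulrS fctE IH. Qed.

Lemma hatA_mulrIn f n : (0 < n)%N -> f *+ n = 0 -> f = 0.
Proof.
move=> n0 H; apply/funext => M; apply: (cinf_mulrIn n0).
by rewrite -hatA_mulrnE H.
Qed.

Lemma hatA_sumE (I : Type) (r : seq I) (P : pred I) (F : I -> hA) M :
  (\sum_(i <- r | P i) F i) M = \sum_(i <- r | P i) F i M.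
Proof. by elim/big_rec2: _ => // i x y _ <-. Qed.

(** Euler's identity: a homogeneous element is recovered from derivatives of
    smaller standard degree. *)
Lemma euler k f : proj std_u std_th k%:Z f = f ->
  f *+ k = \sum_(j < k) (umul j (pdu j.+1 f) *+ j.+1 +
                        tmul j.+1 (pdth j.+1 f) *+ j.+1).
Proof.
move=> fk; apply/funext => M; rewrite hatA_mulrnE hatA_sumE.
under eq_bigr => j _.
  rewrite fctE !hatA_mulrnE umul_pdu tmul_pdth -!mulrnA -mulrnDr; over.
rewrite sumrMnr -fk proj_stdeg; case: eqP => [[<-]|_]; last by rewrite !mul0rn.
by case: M => m S; rewrite {1}stdegE.
Qed.

Lemma stdeg0 M : stdeg M = 0 -> M.1 = mset0 /\ (M.2 = fset0 \/ M.2 = [fset 0]%fset).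
Proof.
case: M => m S /eqP; rewrite /stdeg addn_eq0 /= => /andP[/eqP m0 /eqP S0]; split.
  apply/msetP => x; rewrite mset0E; apply/eqP; rewrite mset_eq0.
  by apply/negP => xm; have := le_sum_seq succn xm; rewrite m0.
have H x : x \in S -> x = 0.
  by move=> xm; have := le_sum_seq id xm; rewrite S0 leqn0 => /eqP.
have [S0'|S0'] := boolP (0 \in S); [right|left]; apply/fsetP => x; rewrite !inE.
  by apply/idP/eqP => [/H|->].
by apply/negP => xS; move: S0'; rewrite -(H _ xS) xS.
Qed.

Lemma proj0E f : proj std_u std_th 0 f = f ->
  f = cmul (f (mset0, fset0)) (one R) +
      cmul (f (mset0, [fset 0]%fset)) (tmul 0 (one R)).
Proof.
move=> f0; apply/funext => -[m S]; rewrite !fctE /cmul tmulE /one /mono /=.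
rewrite -{1}f0 proj_stdeg !xpair_eqE.
have [[/stdeg0[/= -> [->|->]]]|nM] := eqVneq (stdeg (m, S))%:Z 0.
- by rewrite !eqxx inE mulr0 addr0 mulr1.
- have -> : ([fset 0] `\ 0)%fset = fset0 :> {fset nat} by apply/fsetP => x; rewrite !inE andNb.
  rewrite !eqxx inE eqxx /= belowE big_seq_fset0 expr0 !mulr1.
  by case: eqP => [/fsetP /(_ 0)|_]; rewrite ?inE ?mulr0 ?add0r.
move: nM; have [->|_] := eqVneq m mset0; last by rewrite /= !mulr0 if_same mulr0 addr0.
move=> nM; rewrite /=; move: nM.
have [->|S0] := eqVneq S fset0; first by rewrite /stdeg /= enum_mset0 !big_nil ?big_seq_fset0.
have [S1|_] := boolP (0%N \in S); last by rewrite !mulr0 addr0.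
have [S2|] := eqVneq (S `\ 0)%fset fset0; last by rewrite /= !mulr0 addr0.
by rewrite /stdeg -(fsetD1K S1) S2 /= enum_mset0 big_nil fsetU0 big_seq_fset1.
Qed.

Definition sg (b : bool) f : hA := if b then - f else f.

Definition addop T := forall f g, T (f - g) = T f - T g.

(** A super-derivation is determined by its values on generators, stated for a
    difference E of two of them.  Induction on the standard degree: by [euler],
    k f is a sum of products of a generator of positive degree and an element of
    degree less than k.  The shift of the degree by r reduces the claim to
    homogeneous elements. *)
Lemma rigid (s : bool) (r : int) E : addop E -> wshift std_u std_th r E -> E (one R) = 0 ->
  (forall c f, E (cmul c f) = cmul c (E f)) ->
  (forall k f, E (umul k f) = umul k (E f)) ->
  (forall k f, E (tmul k f) = sg s (tmul k (E f))) ->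
  forall f, E f = 0.
Proof.
move=> Eadd Er E1 Ec Eu Et.
pose E' : {additive hA -> hA} :=
  HB.pack E (GRing.isZmodMorphism.Build hA hA E Eadd).
have H n : forall k f, (k < n)%N -> proj std_u std_th k%:Z f = f -> E f = 0.
  elim: n => // n IH k f; rewrite ltnS => kn fk.
  have [k0|k0] := posnP k.
    move: fk; rewrite k0 => /proj0E ->.
    rewrite [LHS](raddfD E') /= !Ec Et E1.
    by rewrite /sg; case: s {Et}; rewrite ?oppr0 raddf0 ?oppr0 !raddf0 addr0.
  apply: (hatA_mulrIn k0); rewrite -[E f]/(E' f) -raddfMn (euler fk) raddf_sum.
  rewrite big1// => j _; rewrite raddfD !raddfMn /= Eu Et.
  have jk := ltn_ord j.
  have kj : k%:Z + - (j.+1)%:Z = (k - j.+1)%N by lia.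
  have lt : (k - j.+1 < n)%N by lia.
  rewrite (IH _ _ lt); last by rewrite -kj wshift_pduS fk.
  rewrite (IH _ _ lt); last by rewrite -kj wshift_pdth fk.
  by rewrite !raddf0 /sg; case: s {Et}; rewrite ?oppr0 !mul0rn addr0.
move=> f; apply: (@proj_ext _ _ _ std_u std_th) => j; rewrite raddf0.
rewrite -[j](subrK r) Er.
case: (j - r) => k.
  by apply: (H k.+1 k) => //; rewrite proj_proj eqxx.
rewrite (_ : proj _ _ _ _ = 0) ?[LHS](raddf0 E')//.
by apply/funext => M; rewrite proj_stdeg.
Qed.

(** Locally finite sums.  The cutoff leaves room for terms of order s - 1, as in
    the homotopy [hty], whose terms u^(s-1) d/dtheta^s lower the degree. *)
Definition lsum F : hA := fun M => \sum_(s < (stdeg M).+2) F s M.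
Definition summable F := forall s, ordge s.-1 (F s).

Lemma lsumW F M n : summable F -> (stdeg M + 2 <= n)%N -> lsum F M = \sum_(s < n) F s M.
Proof.
rewrite addn2 => Fs Mn; rewrite /lsum (big_ord_widen n (fun s => F s M) Mn) big_mkcond /=.
apply: eq_bigr => s _; case: ifPn => //; rewrite -leqNgt => Ms.
by rewrite Fs//; case: (nat_of_ord s) Ms.
Qed.

Lemma lsumD F F' : lsum (fun s => F s + F' s) = lsum F + lsum F'.
Proof. by apply/funext => M; rewrite fctE /lsum -big_split. Qed.

Lemma lsumN F : lsum (fun s => - F s) = - lsum F.
Proof. by apply/funext => M; rewrite fctE /lsum -sumrN. Qed.

Lemma lsum_cmul c F : lsum (fun s => cmul c (F s)) = cmul c (lsum F).
Proof. by apply/funext => M; rewrite /lsum /cmul mulr_sumr. Qed.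

Lemma lsum_umul k F : summable F -> lsum (fun s => umul k (F s)) = umul k (lsum F).
Proof.
move=> Fs; apply/funext => -[m S]; rewrite umulE /=.
under [LHS]eq_bigr do rewrite umulE /=.
case: ifPn => km; last by rewrite big1.
rewrite (lsumW Fs (n := (stdeg (m, S)).+2))//; rewrite (stdegD _ km).
by rewrite addSn addn2 !ltnS leqW ?leq_addl.
Qed.

Lemma lsum_tmul k F : summable F -> lsum (fun s => tmul k (F s)) = tmul k (lsum F).
Proof.
move=> Fs; apply/funext => -[m S]; rewrite tmulE /=.
under [LHS]eq_bigr do rewrite tmulE /=.
case: ifPn => km; last by rewrite big1.
rewrite -mulr_sumr; congr (_ * _).
by rewrite (lsumW Fs (n := (stdeg (m, S)).+2))//; rewrite (stdegDth _ km) addn2 !ltnS leq_addl.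
Qed.

Lemma lsum_delta k f : ordge k.-1 f -> lsum (fun s => if s == k then f else 0) = f.
Proof.
move=> fk; apply/funext => M; rewrite /lsum.
have [lt|ge] := ltnP k (stdeg M).+2.
  rewrite (bigD1 (Ordinal lt))//= eqxx big1 ?addr0// => i ik.
  by rewrite ifN//; apply: contra ik => /eqP e; apply/eqP/val_inj.
rewrite fk; last by case: k ge {fk} => //.
rewrite big1// => i _; rewrite ifN//; apply/eqP => e.
by have := ltn_ord i; rewrite e ltnNge ge.
Qed.

Lemma proj_lsum a b j F : proj a b j (lsum F) = lsum (fun s => proj a b j (F s)).
Proof.
apply/funext => M; rewrite /proj /lsum; case: ifP => // _.
by rewrite big1.
Qed.

End Derivations.

(** * Derivations and their brackets *)

Section Brackets.
Variable R : realType.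
Local Notation hA := (hatA R).
Implicit Types (f g : hA) (c : cinf R) (M : monomial) (T D E : hA -> hA).
Implicit Types (a b : nat -> int) (s : bool) (F : nat -> hA) (X Y : nat -> hA -> hA).

(** What is needed of the multiplication by an element of parity s and order at
    least r: it supercommutes with the generators. *)
Record multop s (r : nat) T : Prop := Multop {
  mul_add : addop T;
  mul_cmul : forall c f, T (cmul c f) = cmul c (T f);
  mul_umul : forall k f, T (umul k f) = umul k (T f);
  mul_tmul : forall k f, T (tmul k f) = sg s (tmul k (T f));
  mul_ord : forall n f, ordge n f -> ordge (r + n) (T f) }.

Lemma multop_zero s r : multop s r (fun _ => 0).
Proof.
split=> [f g|c f|k f|k f|n f _ M _] //; rewrite ?subr0 ?raddf0//.
by rewrite /sg oppr0 if_same.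
Qed.

Lemma multop_id : multop false 0 id.
Proof. by split. Qed.

Lemma multopD s r T T' : multop s r T -> multop s r T' ->
  multop s r (fun f => T f + T' f).
Proof.
move=> [a1 c1 u1 t1 o1] [a2 c2 ub t2 o2]; split=> [f g|c f|k f|k f|n f fn M Mn].
- by rewrite a1 a2 opprD addrACA.
- by rewrite c1 c2 raddfD.
- by rewrite u1 ub raddfD.
- by rewrite t1 t2 raddfD /sg; case: s {t1 t2} => //; rewrite opprD.
- by rewrite fctE (o1 _ _ fn)// (o2 _ _ fn)// addr0.
Qed.

Lemma multop_c s r c T : multop s r T -> multop s r (fun f => cmul c (T f)).
Proof.
move=> [a1 c1 u1 t1 o1]; split=> [f g|c' f|k f|k f|n f fn M Mn].
- by rewrite a1 raddfB.
- by rewrite c1 !cmulA mulrC.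
- by rewrite u1 cmul_u.
- by rewrite t1 /sg; case: s {t1}; rewrite ?raddfN cmul_t.
- by rewrite /cmul (o1 _ _ fn)// mulr0.
Qed.

Lemma multop_u s r k T : multop s r T -> multop s (k.+1 + r) (fun f => umul k (T f)).
Proof.
move=> [a1 c1 u1 t1 o1]; split=> [f g|c f|j f|j f|n f fn].
- by rewrite a1 raddfB.
- by rewrite c1 cmul_u.
- by rewrite u1 u_uC.
- by rewrite t1 /sg; case: s {t1}; rewrite ?raddfN t_u.
- by rewrite -addnA; rewrite umul.unlock; apply: ordge_u; apply: o1.
Qed.

Lemma multop_t s r k T : multop s r T -> multop (~~ s) (k + r) (fun f => tmul k (T f)).
Proof.
move=> [a1 c1 u1 t1 o1]; split=> [f g|c f|j f|j f|n f fn].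
- by rewrite a1 raddfB.
- by rewrite c1 cmul_t.
- by rewrite u1 t_u.
- by rewrite t1 /sg; case: s {t1}; rewrite /= ?raddfN t_tC ?opprK.
- by rewrite -addnA; rewrite tmul.unlock; apply: ordge_th; apply: o1.
Qed.

Lemma multopW s r r' T : (r' <= r)%N -> multop s r T -> multop s r' T.
Proof.
move=> rr [a1 c1 u1 t1 o1]; split=> // n f fn M Mn.
by apply: (o1 _ _ fn); apply: leq_trans Mn _; rewrite leq_add2r.
Qed.

(** D is a derivation of parity s.  Its values on u^k and theta^k enter through
    the operators X k and Y k of multiplication by them. *)
Record isder s X Y D : Prop := Isder {
  der_add : addop D;
  der_one : D (one R) = 0;
  der_cmul : forall c f, D (cmul c f) = cmul (cinf_derive c) (X 0%N f) + cmul c (D f);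
  der_umul : forall k f, D (umul k f) = X k.+1 f + umul k (D f);
  der_tmul : forall k f, D (tmul k f) = Y k f + sg s (tmul k (D f)) }.

Definition jetder X Y f : hA := lsum (fun k => X k (pdu k f) + Y k (pdth k f)).

Lemma addop0 T : addop T -> T 0 = 0.
Proof. by move=> H; have := H 0 0; rewrite !subrr. Qed.

Lemma addopD T : addop T -> forall f g, T (f + g) = T f + T g.
Proof.
by move=> H f g; rewrite -[g in LHS]opprK -[- g]sub0r !H (addop0 H) sub0r opprK.
Qed.

Lemma addopN T : addop T -> forall f, T (- f) = - T f.
Proof. by move=> H f; rewrite -[- f]sub0r H (addop0 H) sub0r. Qed.

(** Chain rule: the derivation with prescribed values on the generators is
    sum X k d/du^k + Y k d/dtheta^k. *)
Lemma jetder_isder s X Y : (forall k, multop s k.-1 (X k)) ->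
  (forall k, multop (~~ s) k.-1 (Y k)) -> isder s X Y (jetder X Y).
Proof.
move=> HX HY.
have slX F : summable (fun k => X k (F k)).
  by move=> k; rewrite -[k.-1]addn0; apply: (mul_ord (HX k)); apply: ordge0.
have slY F : summable (fun k => Y k (F k)).
  by move=> k; rewrite -[k.-1]addn0; apply: (mul_ord (HY k)); apply: ordge0.
have sl f : summable (fun k => X k (pdu k f) + Y k (pdth k f)).
  by move=> k M Mk; rewrite fctE (slX (fun k => pdu k f))// (slY (fun k => pdth k f))// addr0.
have slX0 k f : ordge k.-1 (X k f) by apply: (slX (fun=> f)).
have slY0 k f : ordge k.-1 (Y k f) by apply: (slY (fun=> f)).
split=> [f g||c f|k f|k f]; rewrite /jetder.
- rewrite -lsumN -lsumD; congr lsum; apply/funext => k.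
  by rewrite !raddfB (mul_add (HX k)) (mul_add (HY k)) opprD addrACA.
- apply/funext => M; rewrite /lsum big1// => k _.
  by rewrite pdu_one pdth_one (addop0 (mul_add (HX k))) (addop0 (mul_add (HY k))) addr0.
- rewrite -lsum_cmul -[X in X + _](@lsum_delta _ 0); last exact: ordge0.
  rewrite -lsumD; congr lsum; apply/funext => -[|k] /=.
    rewrite pdu0_cmul pdth_cmul (addopD (mul_add (HX 0%N))) !(mul_cmul (HX 0%N)).
    by rewrite (mul_cmul (HY 0%N)) raddfD addrA.
  by rewrite pduS_cmul pdth_cmul (mul_cmul (HX k.+1)) (mul_cmul (HY k.+1)) raddfD add0r.
- rewrite -(lsum_umul _ (sl f)) -[X in X + _](@lsum_delta _ k.+1)//.
  rewrite -lsumD; congr lsum; apply/funext => j.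
  rewrite pdu_umul pdth_umul (addopD (mul_add (HX j))) (mul_umul (HX j)) (mul_umul (HY j)).
  have -> : X j (if j == k.+1 then f else 0) = if j == k.+1 then X k.+1 f else 0.
    by case: eqP => [->//|_]; rewrite (addop0 (mul_add (HX j))).
  by rewrite raddfD [X in X + _]addrC -addrA.
- have -> : sg s (tmul k (lsum (fun j => X j (pdu j f) + Y j (pdth j f)))) =
      lsum (fun j => sg s (tmul k (X j (pdu j f) + Y j (pdth j f)))).
    rewrite -(lsum_tmul _ (sl f)) /sg; case: s {HX HY slX slY sl slX0 slY0} => //.
    by rewrite -lsumN.
  rewrite -[X in X + _](@lsum_delta _ k)//.
  rewrite -lsumD; congr lsum; apply/funext => j.
  rewrite pdu_tmul pdth_tmul (mul_add (HY j)) (mul_tmul (HX j)) (mul_tmul (HY j)).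
  have -> : Y j (if j == k then f else 0) = if j == k then Y k f else 0.
    by case: eqP => [->//|_]; rewrite (addop0 (mul_add (HY j))).
  rewrite addrCA; congr (_ + _).
  by rewrite raddfD /sg; case: s {HX HY slX slY sl slX0 slY0}; rewrite /= ?opprD ?opprK.
Qed.

Lemma dx_jetder f : dx f = jetder (fun k => umul k) (fun k => tmul k.+1) f.
Proof.
apply/funext => M; rewrite /jetder /lsum (@dxW _ _ _ (stdeg M).+2)//.
by apply: eq_bigr => k _; rewrite umul.unlock tmul.unlock.
Qed.

Lemma isder_dx : isder false (fun k => umul k) (fun k => tmul k.+1) (@dx R).
Proof.
rewrite (_ : @dx R = jetder (fun k => umul k) (fun k => tmul k.+1)); last by apply/funext => f; exact: dx_jetder.
apply: jetder_isder => k.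
  by apply: multopW (multop_u k multop_id); rewrite addn0; lia.
by apply: multopW (multop_t k.+1 multop_id); rewrite addn0; lia.
Qed.

(** The commutator with dx is again a derivation, so by [rigid] it is enough to
    compare the values on generators. *)
Lemma der_comm s X Y D r : isder s X Y D -> wshift std_u std_th r D ->
  wshift std_u std_th 1 (@dx R) ->
  (forall f, X 0%N (umul 0 f) = umul 0 (X 0%N f)) ->
  (forall k f, dx (X k f) = X k.+1 f + X k (dx f)) ->
  (forall k f, dx (Y k f) = Y k.+1 f + Y k (dx f)) ->
  forall f, dx (D f) = D (dx f).
Proof.
move=> [a1 o1 c1 u1 t1] sD s1 X0 HX HY f; apply/eqP; rewrite -subr_eq0; apply/eqP.
have [a2 o2 c2 ub t2] := isder_dx.
move: f; apply: (@rigid _ s (r + 1)).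
- by move=> f g; rewrite a1 !raddfB /= a1; apply/funext => M; rewrite !fctE; ring.
- apply: wshiftD; first exact: (wshift_comp s1 sD).
  by apply: wshiftN; rewrite addrC; apply: (wshift_comp sD s1).
- by rewrite o1 o2 (addop0 a1) raddf0 subr0.
- move=> c f; rewrite c1 c2 (addopD a1) raddfD /= !c1 !c2 /= u1 HX X0.
  apply/funext => M; rewrite /cmul !fctE; ring.
- move=> k f; rewrite u1 ub (addopD a1) raddfD /= !u1 !ub HX raddfB /=.
  apply/funext => M; rewrite !fctE; ring.
- move=> k f; rewrite t1 t2 (addopD a1) raddfD /= !t1 HY /sg.
  case: s {t1}; rewrite ?raddfN /= !t2 raddfB /=; apply/funext => M; rewrite !fctE /sg; ring.
Qed.

(** The anticommutator of two odd derivations is an even derivation, hence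
    equal by [rigid] to the one, E, that has its values.  The condition on X 0 and X' 0 removes the second
    derivative of the coefficient function c in D (D' (c f)) + D' (D (c f)). *)
Lemma der_anticomm X Y D X' Y' D' X2 Y2 E r r' :
  isder true X Y D -> isder true X' Y' D' -> isder false X2 Y2 E ->
  wshift std_u std_th r D -> wshift std_u std_th r' D' -> wshift std_u std_th (r + r') E ->
  (forall f, X 0%N (X' 0%N f) + X' 0%N (X 0%N f) = 0) ->
  (forall k f, D (X' k f) + X' k (D f) + D' (X k f) + X k (D' f) = X2 k f) ->
  (forall k f, D (Y' k f) - Y' k (D f) + D' (Y k f) - Y k (D' f) = Y2 k f) ->
  forall f, D (D' f) + D' (D f) = E f.
Proof.
move=> [a1 o1 c1 u1 t1] [a2 o2 c2 ub t2] [a3 o3 c3 u3 t3] s1 s2 s3 X0 HX HY f.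
apply/eqP; rewrite -subr_eq0; apply/eqP.
move: f; apply: (@rigid _ false (r + r')).
- move=> f g; rewrite !(a1, a2, a3); apply/funext => M; rewrite !fctE; ring.
- apply: wshiftD; last exact: wshiftN.
  apply: wshiftD; last exact: (wshift_comp s2 s1).
  by rewrite addrC; apply: (wshift_comp s1 s2).
- by rewrite o1 o2 o3 (addop0 a1) (addop0 a2) addr0 subr0.
- move=> c f; rewrite c1 c2 c3 (addopD a1) (addopD a2) !c1 !c2 -HX.
  have := X0 f; move/eqP; rewrite addrC addr_eq0 => /eqP ->.
  apply/funext => M; rewrite /cmul !fctE; ring.
- move=> k f; rewrite u1 ub u3 (addopD a1) (addopD a2) !u1 !ub -HX ?(raddfB (umul k)) ?(raddfD (umul k)) /=.
  apply/funext => M; rewrite !fctE; ring.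
- move=> k f; rewrite t1 t2 t3 (addopD a1) (addopD a2) /sg (addopN a1) (addopN a2) !t1 !t2 -HY.
  rewrite /sg ?(raddfB (tmul k)) ?(raddfD (tmul k)) /=; apply/funext => M; rewrite !fctE; ring.
Qed.

End Brackets.

(** * The differentials and their components *)

Section Operators.
Variable R : realType.
Local Notation hA := (hatA R).
Implicit Types (f g : hA) (c : cinf R) (M : monomial) (T D E : hA -> hA).
Implicit Types (a b : nat -> int) (s : bool) (X Y : nat -> hA -> hA).

(** The weights used: std is the standard degree, sup the super degree, jet the
    jet number, (jet_u, form_th) the number of factors u^s, theta^(s+1) with
    s >= 1, and eul = std - sup + 2 jet. *)
Definition sup_u (k : nat) : int := 0.
Definition sup_th (s : nat) : int := 1.
Definition jet_u (k : nat) : int := 1.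
Definition jet_th (s : nat) : int := 0.
Definition form_th (s : nat) : int := (1 < s)%N%:Z.
Definition eul_u (k : nat) : int := k.+3%:Z.
Definition eul_th (s : nat) : int := s%:Z - 1.

(** If T is the multiplication by X, then [ad T] is the multiplication by dx X. *)
Definition ad T f : hA := dx (T f) - T (dx f).

Lemma adE T f : dx (T f) = ad T f + T (dx f).
Proof. by rewrite /ad subrK. Qed.

(** Multiplications by polynomials in the u^k, k >= 1, and the theta^k, of parity
    s, super degree p, standard degree d and jet number m. *)
Inductive polyop : bool -> nat -> nat -> nat -> (hA -> hA) -> Prop :=
| polyop_id : polyop false 0 0 0 id
| polyop_zero s p d m : polyop s p d m (fun _ => 0)
| polyopD s p d m T T' : polyop s p d m T -> polyop s p d m T' ->
    polyop s p d m (fun f => T f + T' f)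
| polyop_u k s p d m T : polyop s p d m T ->
    polyop s p (k.+1 + d) m.+1 (fun f => umul k (T f))
| polyop_t k s p d m T : polyop s p d m T ->
    polyop (~~ s) p.+1 (k + d) m (fun f => tmul k (T f)).

Lemma polyop_multop s p d m T : polyop s p d m T -> multop s d T.
Proof.
elim=> {s p d m T} [|s p d m|s p d m T T' _ H _ H'|k s p d m T _ H|k s p d m T _ H].
- exact: multop_id.
- exact: multop_zero.
- exact: multopD.
- exact: multop_u.
- exact: multop_t.
Qed.

Lemma polyop_shift s p d m T : polyop s p d m T ->
  [/\ wshift sup_u sup_th p T, wshift std_u std_th d T & wshift jet_u jet_th m T].
Proof.
elim=> {s p d m T} [|s p d m|s p d m T T' _ [p1 d1 m1] _ [p2 d2 m2]
  |k s p d m T _ [p1 d1 m1]|k s p d m T _ [p1 d1 m1]].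
- by split; apply: wshift_id.
- by split; apply: wshift0.
- by split; apply: wshiftD.
- have U a b := @wshift_umul R a b k.
  split; [rewrite -[p%:Z]addr0|rewrite PoszD addrC|rewrite -addn1 PoszD].
  + exact: (wshift_comp (U _ _) p1).
  + exact: (wshift_comp (U _ _) d1).
  + exact: (wshift_comp (U _ _) m1).
- have U a b := @wshift_tmul R a b k.
  split; [rewrite -addn1 PoszD|rewrite PoszD addrC|rewrite -[m%:Z]addr0].
  + exact: (wshift_comp (U _ _) p1).
  + exact: (wshift_comp (U _ _) d1).
  + exact: (wshift_comp (U _ _) m1).
Qed.

Lemma dx_umul k f : dx (umul k f) = umul k.+1 f + umul k (dx f).
Proof. exact: der_umul (isder_dx R) k f. Qed.

Lemma dx_tmul k f : dx (tmul k f) = tmul k.+1 f + tmul k (dx f).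
Proof. exact: der_tmul (isder_dx R) k f. Qed.

Lemma dx_cmul c f : dx (cmul c f) = cmul (cinf_derive c) (umul 0 f) + cmul c (dx f).
Proof. exact: der_cmul (isder_dx R) c f. Qed.

Lemma polyop_ad s p d m T : polyop s p d m T -> polyop s p d.+1 m (ad T).
Proof.
elim=> {s p d m T} [|s p d m|s p d m T T' _ H _ H'|k s p d m T H0 H|k s p d m T H0 H].
- rewrite (_ : ad id = fun _ => 0); first exact: polyop_zero.
  by apply/funext => f; rewrite /ad subrr.
- rewrite (_ : ad _ = fun _ => 0); first exact: polyop_zero.
  by apply/funext => f; rewrite /ad raddf0 subrr.
- rewrite (_ : ad _ = fun f => ad T f + ad T' f); first exact: polyopD.
  by apply/funext => f; rewrite /ad raddfD opprD addrACA.
- rewrite (_ : ad _ = fun f => umul k.+1 (T f) + umul k (ad T f)).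
    by apply: polyopD; [exact: (polyop_u k.+1 H0)|rewrite -addnS; exact: (polyop_u k H)].
  by apply/funext => f; rewrite /ad dx_umul raddfB addrA.
- rewrite (_ : ad _ = fun f => tmul k.+1 (T f) + tmul k (ad T f)).
    by apply: polyopD; [exact: (polyop_t k.+1 H0)|rewrite -addnS; exact: (polyop_t k H)].
  by apply/funext => f; rewrite /ad dx_tmul raddfB addrA.
Qed.

(** [xop k] and [yop k] are the multiplications by dx^k (2 u theta^1 + u^1 theta)
    and dx^k (theta theta^1), the values of DD2 on u^k and theta^k, and [wop k] is
    the part of [xop k] free of u.  The step for [wop] contains the term
    2 u^1 theta^(k+1) that dx produces from 2 u theta^(k+1). *)
Fixpoint wop (k : nat) : hA -> hA :=
  if k is j.+1 then
    fun f => ad (wop j) f + (umul 0 (tmul k f) + umul 0 (tmul k f))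
  else fun f => umul 0 (tmul 0 f).

Fixpoint yop (k : nat) : hA -> hA :=
  if k is j.+1 then ad (yop j) else fun f => tmul 0 (tmul 1 f).

Lemma polyop_wop k : polyop true 1 k.+1 1 (wop k).
Proof.
elim: k => [|k IH].
  exact: (polyop_u 0 (polyop_t 0 polyop_id)).
apply: polyopD; first exact: polyop_ad.
by have := polyop_u 0 (polyop_t k.+1 polyop_id); rewrite addn0 => H; apply: polyopD.
Qed.

Lemma polyop_yop k : polyop false 2 k.+1 0 (yop k).
Proof.
elim: k => [|k IH]; last exact: polyop_ad.
exact: (polyop_t 0 (polyop_t 1 polyop_id)).
Qed.

Definition twice_u : cinf R := cinf_id R + cinf_id R.
Definition xop (k : nat) f : hA := cmul twice_u (tmul k.+1 f) + wop k f.

Lemma twice_u_derive : cinf_derive twice_u = 1 + 1.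
Proof. by rewrite raddfD /= cinf_derive_id. Qed.

Lemma multop_xop k : multop true k.+1 (xop k).
Proof.
apply: multopD; last exact: polyop_multop (polyop_wop k).
by have := multop_c twice_u (multop_t k.+1 (multop_id R)); rewrite addn0.
Qed.

Lemma dx_xop k f : dx (xop k f) = xop k.+1 f + xop k (dx f).
Proof.
rewrite /xop raddfD /= dx_cmul dx_tmul twice_u_derive adE.
rewrite (raddfD (cmul twice_u)) /= -t_u /cmul.
apply/funext => M; rewrite !fctE t_u; ring.
Qed.

Lemma dx_yop k f : dx (yop k f) = yop k.+1 f + yop k (dx f).
Proof. exact: adE. Qed.

(** De Rham differential in the variables u^s, s >= 1, with theta^(s+1) in the
    role of du^s. *)
Definition dR : hA -> hA :=
  jetder (fun k => if k is j.+1 then @tmul R j.+2 else fun _ => 0) (fun _ _ => 0).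
Definition dbase f : hA := tmul 1 (pdu 0 f).
Definition D1 f : hA := dR f + dbase f.
(** The part of DD2 that is linear over the functions of u: it preserves the jet
    number and does not differentiate in u. *)
Definition del : hA -> hA :=
  jetder (fun k => if k is j.+1 then wop j.+1 else fun _ => 0) yop.
Definition DD2 : hA -> hA := jetder xop yop.
(** Contraction with the Euler vector field of the u^s, s >= 1: the Poincare
    homotopy of dR. *)
Definition hty : hA -> hA :=
  jetder (fun _ _ => 0) (fun k => if k is j.+2 then @umul R j else fun _ => 0).

Lemma isder_dR : isder true (fun k => if k is j.+1 then @tmul R j.+2 else fun _ => 0)
  (fun _ _ => 0) dR.
Proof.
apply: jetder_isder => -[|k]; try exact: multop_zero.
by apply: multopW (multop_t k.+2 (multop_id R)); lia.
Qed.

Lemma isder_dbase : isder true (fun k => if k is 0 then @tmul R 1 else fun _ => 0)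
  (fun _ _ => 0) dbase.
Proof.
split=> [f g||c f|k f|k f]; rewrite /dbase.
- by rewrite !raddfB.
- by rewrite pdu_one raddf0.
- by rewrite pdu0_cmul raddfD /= !cmul_t.
- by rewrite pdu_umul addr0 t_u add0r.
- by rewrite pdu_tmul t_tC add0r.
Qed.

Lemma isder_D1 : isder true (fun k => tmul k.+1) (fun _ _ => 0) D1.
Proof.
have [a1 o1 c1 u1 t1] := isder_dR; have [a2 o2 c2 ub t2] := isder_dbase.
split=> [f g||c f|k f|k f]; rewrite /D1.
- by rewrite a1 a2 opprD addrACA.
- by rewrite o1 o2 addr0.
- by rewrite c1 c2 raddf0 add0r raddfD addrCA.
- by rewrite u1 ub add0r raddfD addrA.
- by rewrite t1 t2 /sg !add0r raddfD opprD.
Qed.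

Lemma isder_del : isder true (fun k => if k is j.+1 then wop j.+1 else fun _ => 0) yop del.
Proof.
apply: jetder_isder => k; last by apply: multopW (polyop_multop (polyop_yop k)); lia.
case: k => [|k]; first exact: multop_zero.
by apply: multopW (polyop_multop (polyop_wop k.+1)); lia.
Qed.

Lemma isder_DD2 : isder true xop yop DD2.
Proof.
apply: jetder_isder => k; last by apply: multopW (polyop_multop (polyop_yop k)); lia.
by apply: multopW (multop_xop k); lia.
Qed.

Lemma isder_hty : isder true (fun _ _ => 0)
  (fun k => if k is j.+2 then @umul R j else fun _ => 0) hty.
Proof.
apply: jetder_isder => k; first exact: multop_zero.
case: k => [|[|k]]; try exact: multop_zero.
by apply: multopW (multop_u k (multop_id R)); lia.
Qed.

Lemma isder_pdth1 : isder true (fun _ _ => 0)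
  (fun k => if k == 1%N then id else fun _ => 0) (@pdth R 1).
Proof.
split=> [f g||c f|k f|k f].
- exact: raddfB.
- exact: pdth_one.
- by rewrite pdth_cmul raddf0 add0r.
- by rewrite pdth_umul add0r.
- by rewrite pdth_tmul eq_sym; case: eqP.
Qed.

Lemma isder_zero : isder false (fun _ _ => 0) (fun _ _ => 0) (fun _ : hA => 0).
Proof.
by split=> [f g||c f|k f|k f] //; rewrite ?subr0 /sg ?raddf0 ?addr0.
Qed.

Definition wdiag a b := diag (fun j => j%:~R : cinf R) a b.

Lemma isder_diag a b : isder false
  (fun k => if k is j.+1 then (fun f => cmul (a j)%:~R (umul j f)) else fun _ => 0)
  (fun k f => cmul (b k)%:~R (tmul k f)) (wdiag a b).
Proof.
split=> [f g||c f|k f|k f].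
- exact: raddfB.
- apply/funext => M; rewrite /wdiag /diag /one /mono.
  case: eqP => [->|_]; last by rewrite mulr0.
  by rewrite /wt /= enum_mset0 big_nil big_seq_fset0 addr0 mul0r.
- rewrite raddf0 add0r; apply/funext => M; rewrite /wdiag /diag /cmul; ring.
- apply/funext => -[m S]; rewrite /wdiag /diag fctE /cmul !umulE /=.
  case: ifPn => km; last by rewrite !mulr0 addr0.
  by rewrite (wtD _ _ _ km) intrD mulrDl.
- apply/funext => -[m S]; rewrite /wdiag /diag /sg fctE /cmul !tmulE /=.
  case: ifPn => km; last by rewrite !mulr0 addr0.
  rewrite (wtDth _ _ _ km) intrD; ring.
Qed.

End Operators.

(** * Relations of the bihamiltonian complex *)

Section Identities.
Variable R : realType.
Local Notation hA := (hatA R).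
Implicit Types (f g : hA) (c : cinf R) (M : monomial) (T D E : hA -> hA).
Implicit Types (a b : nat -> int) (s : bool) (X Y : nat -> hA -> hA).
Local Notation wop := (@wop R). Local Notation yop := (@yop R).
Local Notation dR := (@dR R). Local Notation dbase := (@dbase R).
Local Notation D1 := (@D1 R). Local Notation DD2 := (@DD2 R).
Local Notation del := (@del R). Local Notation hty := (@hty R).
Local Notation xop := (@xop R). Local Notation twice_u := (twice_u R).

Lemma hatA0E M : (0 : hA) M = 0. Proof. by []. Qed.

Lemma dRB : addop dR. Proof. exact: der_add (isder_dR R). Qed.
Lemma dbaseB : addop dbase. Proof. exact: der_add (isder_dbase R). Qed.
Lemma D1B : addop D1. Proof. exact: der_add (isder_D1 R). Qed.
Lemma DD2B : addop DD2. Proof. exact: der_add (isder_DD2 R). Qed.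
Lemma delB : addop del. Proof. exact: der_add (isder_del R). Qed.
Lemma htyB : addop hty. Proof. exact: der_add (isder_hty R). Qed.
HB.instance Definition _ := GRing.isZmodMorphism.Build hA hA dR dRB.
HB.instance Definition _ := GRing.isZmodMorphism.Build hA hA dbase dbaseB.
HB.instance Definition _ := GRing.isZmodMorphism.Build hA hA D1 D1B.
HB.instance Definition _ := GRing.isZmodMorphism.Build hA hA DD2 DD2B.
HB.instance Definition _ := GRing.isZmodMorphism.Build hA hA del delB.
HB.instance Definition _ := GRing.isZmodMorphism.Build hA hA hty htyB.
Lemma wopB k : addop (wop k). Proof. exact: mul_add (polyop_multop (polyop_wop R k)). Qed.
Lemma yopB k : addop (yop k). Proof. exact: mul_add (polyop_multop (polyop_yop R k)). Qed.
Lemma xopB k : addop (xop k). Proof. exact: mul_add (multop_xop R k). Qed.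
HB.instance Definition _ k := GRing.isZmodMorphism.Build hA hA (wop k) (wopB k).
HB.instance Definition _ k := GRing.isZmodMorphism.Build hA hA (yop k) (yopB k).
HB.instance Definition _ k := GRing.isZmodMorphism.Build hA hA (xop k) (xopB k).

Lemma jetder_shift a b r X Y : wshift a b r (X 0%N) ->
  (forall k, wshift a b (a k + r) (X k.+1)) ->
  (forall k, wshift a b (b k + r) (Y k)) -> wshift a b r (jetder X Y).
Proof.
move=> X0 XS HY j f; rewrite /jetder proj_lsum; congr lsum; apply/funext => k.
rewrite raddfD /=; congr (_ + _).
  case: k => [|k]; first by rewrite X0 -(wshift_proj0 (@wshift_pdu0 R a b)).
  by rewrite -wshift_pduS -XS; congr (proj _ _ _ _); lia.
by rewrite -wshift_pdth -HY; congr (proj _ _ _ _); lia.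
Qed.

Lemma wshift_eq a b r r' T : wshift a b r T -> r = r' -> wshift a b r' T.
Proof. by move=> H <-. Qed.

Lemma wshift_dx : wshift std_u std_th 1 (@dx R).
Proof.
rewrite (_ : @dx R = jetder (fun k => umul k) (fun k => tmul k.+1)); last first.
  by apply/funext => f; exact: dx_jetder.
apply: jetder_shift => [|k|k]; first exact: wshift_umul.
  by apply: wshift_eq (@wshift_umul _ _ _ _) _; rewrite /std_u; lia.
by apply: wshift_eq (@wshift_tmul _ _ _ _) _; rewrite /std_th; lia.
Qed.

Lemma wshift_dx_p : wshift sup_u sup_th 0 (@dx R).
Proof.
rewrite (_ : @dx R = jetder (fun k => umul k) (fun k => tmul k.+1)); last first.
  by apply/funext => f; exact: dx_jetder.
apply: jetder_shift => [|k|k]; first exact: wshift_umul.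
  by apply: wshift_eq (@wshift_umul _ _ _ _) _.
by apply: wshift_eq (@wshift_tmul _ _ _ _) _.
Qed.

Lemma wshift_dR a b r : (forall k, b k.+2 = a k + r) -> wshift a b r dR.
Proof.
move=> H; apply: jetder_shift => [|k|k]; try exact: wshift0.
by apply: wshift_eq (@wshift_tmul _ _ _ _) _; rewrite H.
Qed.

Lemma wshift_hty a b r : (forall k, b k.+2 = a k + r) -> wshift a b (- r) hty.
Proof.
move=> H; apply: jetder_shift => [|k|[|[|k]]]; try exact: wshift0.
by apply: wshift_eq (@wshift_umul _ _ _ _) _; rewrite H addrK.
Qed.

Lemma wshift_dbase a b : wshift a b (b 1%N) dbase.
Proof.
rewrite -[b 1%N]add0r.
exact: (wshift_comp (@wshift_tmul R a b 1) (@wshift_pdu0 R a b)).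
Qed.

Lemma wshift_del : [/\ wshift sup_u sup_th 1 del, wshift std_u std_th 1 del & wshift jet_u jet_th 0 del].
Proof.
split; (apply: jetder_shift => [|k|k]; first exact: wshift0).
- by have [H _ _] := polyop_shift (polyop_wop R k.+1).
- by have [H _ _] := polyop_shift (polyop_yop R k).
- have [_ H _] := polyop_shift (polyop_wop R k.+1).
  by apply: wshift_eq H _; rewrite /std_u; lia.
- have [_ H _] := polyop_shift (polyop_yop R k).
  by apply: wshift_eq H _; rewrite /std_th; lia.
- by have [_ _ H] := polyop_shift (polyop_wop R k.+1).
- by have [_ _ H] := polyop_shift (polyop_yop R k).
Qed.

Definition dup f : hA := umul 0 (tmul 0 (pdu 0 f)).
Lemma dupB : addop dup. Proof. by move=> f g; rewrite /dup !raddfB. Qed.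
HB.instance Definition _ := GRing.isZmodMorphism.Build hA hA dup dupB.

Lemma wshift_dup a b : wshift a b (a 0%N + b 0%N) dup.
Proof.
apply: wshift_eq (wshift_comp (@wshift_umul R a b 0)
  (wshift_comp (@wshift_tmul R a b 0) (@wshift_pdu0 R a b))) _.
by rewrite add0r addrC.
Qed.

Lemma jetder_add X Y X' Y' f :
  jetder X Y f + jetder X' Y' f = jetder (fun k g => X k g + X' k g) (fun k g => Y k g + Y' k g) f.
Proof. by rewrite /jetder -lsumD; congr lsum; apply/funext => k; rewrite addrACA. Qed.

(** DD2 sorted by jet number: dR lowers it, dbase and del preserve it, dup
    raises it. *)
Lemma DD2_split f : DD2 f = cmul twice_u (D1 f) + del f + dup f.
Proof.
have jetder0 (T : hA -> hA) : addop T ->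
    T (pdu 0 f) = jetder (fun k => if k is 0 then T else fun=> 0) (fun _ _ => 0) f.
  move=> HT; rewrite /jetder -[LHS](@lsum_delta _ 0); last exact: ordge0.
  by congr lsum; apply/funext => -[|k]; rewrite /= addr0.
have tB k : addop (tmul k : hA -> hA) by move=> g h; rewrite raddfB.
have jetderc c X Y : cmul c (jetder X Y f) = jetder (fun k g => cmul c (X k g)) (fun k g => cmul c (Y k g)) f.
  by rewrite /jetder -lsum_cmul; congr lsum; apply/funext => k; rewrite raddfD.
rewrite /dup /D1 /dbase /del /dR (jetder0 (tmul 1))// (jetder0 (fun g => umul 0 (tmul 0 g))); last first.
  by move=> g h; rewrite !raddfB.
rewrite jetder_add jetderc !jetder_add /DD2 /jetder; congr lsum; apply/funext => k.
rewrite !addr0 raddf0 add0r; congr (_ + _).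
by case: k => [|k]; rewrite /xop ?add0r ?addr0.
Qed.

Lemma wshift_D1 a b r : (forall k, b k.+2 = a k + r) -> b 1%N = r -> wshift a b r D1.
Proof.
by move=> H H1; apply: wshiftD; [exact: wshift_dR|rewrite -H1; exact: wshift_dbase].
Qed.

Lemma wshift_D1_d : wshift std_u std_th 1 D1.
Proof. by apply: wshift_D1 => // k; rewrite /std_th /std_u; lia. Qed.
Lemma wshift_D1_p : wshift sup_u sup_th 1 D1.
Proof. by apply: wshift_D1. Qed.

Lemma wshift_DD2_of a b r : wshift a b r D1 -> wshift a b r del -> wshift a b r dup ->
  wshift a b r DD2.
Proof.
move=> HA Hd HD; rewrite (_ : DD2 = fun f => (cmul twice_u (D1 f) + del f) + dup f); last first.
  by apply/funext => f; exact: DD2_split.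
apply: wshiftD => //; apply: wshiftD => //.
by rewrite -[r]addr0; apply: (wshift_comp (@wshift_cmul _ _ _ _)).
Qed.

Lemma wshift_DD2_d : wshift std_u std_th 1 DD2.
Proof.
have [_ ? _] := wshift_del; apply: wshift_DD2_of => //; first exact: wshift_D1_d.
exact: wshift_dup.
Qed.

Lemma wshift_DD2_p : wshift sup_u sup_th 1 DD2.
Proof.
have [? _ _] := wshift_del; apply: wshift_DD2_of => //; first exact: wshift_D1_p.
exact: wshift_dup.
Qed.

Lemma dx_D1 f : dx (D1 f) = D1 (dx f).
Proof.
apply: (der_comm (isder_D1 R) wshift_D1_d wshift_dx) => [g|k g|k g].
- exact: t_u.
- exact: dx_tmul.
- by rewrite raddf0 addr0.
Qed.

Lemma dx_DD2 f : dx (DD2 f) = DD2 (dx f).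
Proof.
apply: (der_comm (isder_DD2 R) wshift_DD2_d wshift_dx) => [g|k g|k g].
- exact: mul_umul (multop_xop R 0) _ _.
- exact: dx_xop.
- exact: dx_yop.
Qed.

(** For derivations commuting with dx, the values on u^(k+1) and theta^(k+1) come
    from those on u^k and theta^k by applying dx, so that an anticommutator
    vanishes as soon as it kills u and theta. *)
Lemma anticomm_dx X Y D X' Y' D' :
  isder true X Y D -> isder true X' Y' D' ->
  wshift std_u std_th 1 D -> wshift std_u std_th 1 D' ->
  (forall f, dx (D f) = D (dx f)) -> (forall f, dx (D' f) = D' (dx f)) ->
  (forall k f, dx (X k f) = X k.+1 f + X k (dx f)) ->
  (forall k f, dx (Y k f) = Y k.+1 f + Y k (dx f)) ->
  (forall k f, dx (X' k f) = X' k.+1 f + X' k (dx f)) ->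
  (forall k f, dx (Y' k f) = Y' k.+1 f + Y' k (dx f)) ->
  (forall f, X 0%N (X' 0%N f) + X' 0%N (X 0%N f) = 0) ->
  (forall f, D (X' 0%N f) + X' 0%N (D f) + D' (X 0%N f) + X 0%N (D' f) = 0) ->
  (forall f, D (Y' 0%N f) - Y' 0%N (D f) + D' (Y 0%N f) - Y 0%N (D' f) = 0) ->
  forall f, D (D' f) + D' (D f) = 0.
Proof.
move=> H H' s s' cD cD' cX cY cX' cY' X0 HX HY f.
have eX k g : X k.+1 g = dx (X k g) - X k (dx g) by rewrite cX addrK.
have eY k g : Y k.+1 g = dx (Y k g) - Y k (dx g) by rewrite cY addrK.
have eX' k g : X' k.+1 g = dx (X' k g) - X' k (dx g) by rewrite cX' addrK.
have eY' k g : Y' k.+1 g = dx (Y' k g) - Y' k (dx g) by rewrite cY' addrK.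
apply: (der_anticomm H H' (isder_zero R) s s' (wshift0 _ _ _)) => // k g.
- elim: k g => [//|k IH] g; rewrite !eX !eX' (der_add H) (der_add H') -!cD -!cD'.
  have := IH (dx g); have := congr1 (@dx R) (IH g); rewrite !raddfD raddf0 /= -!cD -!cD' => e1 e2.
  rewrite -[RHS](subrr 0) -{1}e1 -e2; apply/funext => M; rewrite !fctE; rewrite ?hatA0E; ring.
- elim: k g => [//|k IH] g; rewrite !eY !eY' (der_add H) (der_add H') -!cD -!cD'.
  have := IH (dx g); have := congr1 (@dx R) (IH g); rewrite !(raddfB, raddfD) raddf0 /= -!cD -!cD' => e1 e2.
  rewrite -[RHS](subrr 0) -{1}e1 -e2; apply/funext => M; rewrite !fctE; rewrite ?hatA0E; ring.
Qed.

Lemma double0 f : f + f = 0 -> f = 0.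
Proof. by rewrite -mulr2n; apply: hatA_mulrIn. Qed.

Lemma D1_D1 f : D1 (D1 f) = 0.
Proof.
apply: double0; move: f; have t := der_tmul (isder_D1 R).
apply: (anticomm_dx (isder_D1 R) (isder_D1 R) wshift_D1_d wshift_D1_d dx_D1 dx_D1);
  move=> *; rewrite ?dx_tmul ?raddf0 ?addr0 ?subr0 ?t_tt ?t//.
  by rewrite addr0.
by rewrite /sg !add0r addNr add0r addNr.
Qed.

Lemma yop1 f : yop 1 f = tmul 0 (tmul 2 f).
Proof.
rewrite /= /ad !dx_tmul raddfD /= t_tt; apply/funext => M; rewrite !fctE; rewrite ?hatA0E; ring.
Qed.

Lemma wop1 f : wop 1 f = umul 1 (tmul 0 f) + (umul 0 (tmul 1 f) + umul 0 (tmul 1 f) + umul 0 (tmul 1 f)).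
Proof.
rewrite /= /ad !dx_umul !dx_tmul raddfD /=; apply/funext => M; rewrite !fctE; rewrite ?hatA0E; ring.
Qed.

Lemma D1_DD2 f : D1 (DD2 f) + DD2 (D1 f) = 0.
Proof.
move: f; have [_ _ cA uA tA] := isder_D1 R; have [_ _ cB uB tB] := isder_DD2 R.
apply: (anticomm_dx (isder_D1 R) (isder_DD2 R) wshift_D1_d wshift_DD2_d dx_D1 dx_DD2).
- by move=> k f; exact: dx_tmul.
- by move=> *; rewrite raddf0 addr0.
- exact: dx_xop.
- exact: dx_yop.
- move=> f /=; rewrite /xop /= raddfD /= cmul_t !t_tt t_u raddf0 add0r (t_tC 0 1).
  by rewrite raddfN add0r subrr.
- move=> f; rewrite /xop /= (raddfD D1) /= cA uA !tA tB yop1 twice_u_derive.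
  rewrite /sg !add0r; move: (D1 f) => Af.
  rewrite !(raddfD, raddfN) /= ?(cmul_t, t_u, t_tt).
  rewrite (t_tC 0 2); apply/funext => M; rewrite /cmul !fctE; rewrite ?hatA0E; ring.
- by move=> f /=; rewrite !tA /sg !add0r !raddfN /= !opprK raddf0 subrr addr0 subr0.
Qed.

Lemma DD2_DD2 f : DD2 (DD2 f) = 0.
Proof.
apply: double0; move: f; have [_ _ cB uB tB] := isder_DD2 R.
apply: (anticomm_dx (isder_DD2 R) (isder_DD2 R) wshift_DD2_d wshift_DD2_d dx_DD2 dx_DD2).
- exact: dx_xop.
- exact: dx_yop.
- exact: dx_xop.
- exact: dx_yop.
- move=> f /=; rewrite /xop /= !raddfD /= !cmul_t !t_u !cmul_u !t_tt (t_tC 1 0) !raddfN /=.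
  by rewrite ?raddf0; apply/funext => M; rewrite /cmul !fctE; rewrite ?hatA0E; ring.
- move=> f; suff e : DD2 (xop 0 f) + xop 0 (DD2 f) = 0 by rewrite e add0r e.
  rewrite /xop /= raddfD /= cB uB !tB yop1 twice_u_derive /xop wop1 /=.
  rewrite /sg !(raddfD, raddfN) /= ?(t_tt, t_u, (t_tC 1 0), (t_tC 2 0)) !(raddfD, raddfN, raddf0) /=.
  by apply/funext => M; rewrite /cmul !fctE; rewrite ?hatA0E; ring.
- move=> f /=; rewrite !tB yop1 /= /sg !(raddfD, raddfN) /= ?(t_tt, raddf0).
  by apply/funext => M; rewrite !fctE; rewrite ?hatA0E; ring.
Qed.

End Identities.

(** * Homotopies *)

Section Homotopies.
Variable R : realType.
Local Notation hA := (hatA R).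
Implicit Types (f g : hA) (c : cinf R) (M : monomial) (T D E : hA -> hA).
Local Notation wop := (@wop R). Local Notation yop := (@yop R).
Local Notation dR := (@dR R). Local Notation dbase := (@dbase R).
Local Notation D1 := (@D1 R). Local Notation DD2 := (@DD2 R).
Local Notation del := (@del R). Local Notation hty := (@hty R).
Local Notation xop := (@xop R). Local Notation twice_u := (twice_u R).
Local Notation h := (@pdth R 1).

Lemma wshift_dR_d : wshift std_u std_th 1 dR.
Proof. by apply: wshift_dR => k; rewrite /std_u /std_th; lia. Qed.
Lemma wshift_hty_d : wshift std_u std_th (- 1) hty.
Proof. by apply: wshift_hty => k; rewrite /std_u /std_th; lia. Qed.

(** Cartan's formula for the Euler vector field. *)
Lemma dR_hty f : dR (hty f) + hty (dR f) = wdiag jet_u form_th f.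
Proof.
move: f; have [_ _ cd ud td] := isder_dR R; have [_ _ ch uh th] := isder_hty R.
apply: (der_anticomm (isder_dR R) (isder_hty R) (isder_diag _ jet_u form_th)
  wshift_dR_d wshift_hty_d) => [|f|k f|k f].
- by apply: wshift_eq (wshift_diag _ _ _ _ _) _.
- by rewrite /= ?raddf0 addr0.
- case: k => [|k]; rewrite /= ?raddf0 !add0r ?raddf0 ?addr0// th /sg /= addrNK.
  by rewrite /jet_u cmul1.
- case: k => [|[|k]] /=; rewrite ?raddf0 ?subr0 ?addr0 ?add0r.
  + by apply/funext => M; rewrite /cmul mul0r.
  + by apply/funext => M; rewrite /cmul mul0r.
  + by rewrite ud addrK cmul1.
Qed.

Lemma dR_dbase f : dR (dbase f) + dbase (dR f) = 0.
Proof.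
move: f; have [_ _ cd ud td] := isder_dR R; have [_ _ ch uh th] := isder_dbase R.
apply: (der_anticomm (isder_dR R) (isder_dbase R) (isder_zero R)
  wshift_dR_d (@wshift_dbase R std_u std_th) (wshift0 _ _ _)) => [f|k f|k f].
- by rewrite /= ?raddf0 addr0.
- case: k => [|k] /=; rewrite ?raddf0 ?add0r ?addr0.
    by rewrite td /sg add0r addNr.
  by rewrite th /sg add0r addNr.
- by rewrite ?raddf0 ?subr0 ?addr0.
Qed.

Lemma h_dR f : h (dR f) + dR (h f) = 0.
Proof.
move: f; have [_ _ cd ud td] := isder_dR R; have [_ _ ch uh th] := isder_pdth1 R.
apply: (der_anticomm (isder_pdth1 R) (isder_dR R) (isder_zero R)
  (@wshift_pdth R std_u std_th 1) wshift_dR_d (wshift0 _ _ _)) => [f|k f|k f].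
- by rewrite add0r.
- case: k => [|k]; rewrite !raddf0 ?addr0//= th /=.
  by rewrite add0r addNr.
- by case: eqP => _; rewrite /= ?raddf0 ?addr0 ?add0r ?subrr.
Qed.

(** As d/dtheta^1 does not commute with dx but [d/dtheta^1, dx] = d/dtheta, the
    values of the contraction h on [wop k] and [yop k] require those of
    d/dtheta. *)
Lemma pdth0_wop k f : pdth 0 (wop k f) + wop k (pdth 0 f) = umul k f.
Proof.
elim: k f => [|k IH] f.
  by rewrite /= pdth_umul pdth_tmul raddfB /= subrK.
rewrite [wop _]/= /ad (raddfD (pdth 0)) (raddfB (pdth 0)) (raddfD (pdth 0)) /= pdth_umul pdth_tmul /= pdth_dx addr0.
have e1 : pdth 0 (wop k f) = umul k f - wop k (pdth 0 f) by rewrite -IH addrK.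
have e2 : pdth 0 (wop k (dx f)) = umul k (dx f) - wop k (dx (pdth 0 f)).
  by rewrite -IH pdth_dx addr0 addrK.
rewrite e1 e2 raddfB /= dx_umul sub0r raddfN /=.
by apply/funext => M; rewrite !fctE; ring.
Qed.

Lemma pdth0_yop k f : pdth 0 (yop k f) - yop k (pdth 0 f) = tmul k.+1 f.
Proof.
elim: k f => [|k IH] f.
  by rewrite /= !pdth_tmul raddfB /= raddf0 sub0r opprK addrK.
rewrite [yop _]/= /ad (raddfB (pdth 0)) /= pdth_dx addr0.
have e1 : pdth 0 (yop k f) = tmul k.+1 f + yop k (pdth 0 f) by rewrite -IH subrK.
have e2 : pdth 0 (yop k (dx f)) = tmul k.+1 (dx f) + yop k (dx (pdth 0 f)).
  by rewrite -IH pdth_dx addr0 subrK.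
rewrite e1 e2 raddfD /= dx_tmul.
by apply/funext => M; rewrite !fctE; ring.
Qed.

(** Passing from k to k + 1: applying dx keeps the coefficient n, and the commutator
    d/dtheta contributes one more. *)
Lemma pdth1_step_wop (W : {additive hA -> hA}) n k :
  (forall f, h (W f) + W (h f) = cmul n%:R (umul k f)) ->
  (forall f, pdth 0 (W f) + W (pdth 0 f) = umul k.+1 f) ->
  forall f, let W' g := dx (W g) - W (dx g) +
      (umul 0 (tmul k.+2 g) + umul 0 (tmul k.+2 g)) in
    h (W' f) + W' (h f) = cmul n.+1%:R (umul k.+1 f).
Proof.
move=> H1 H0 f /=; rewrite (raddfD h) (raddfB h) /= (raddfD h) /= !pdth_umul !pdth_tmul !pdth_dx /=.
have e1 : h (W f) = cmul n%:R (umul k f) - W (h f) by rewrite -H1 addrK.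
have e2 : h (W (dx f)) = cmul n%:R (umul k (dx f)) - W (dx (h f)) - W (pdth 0 f).
  by rewrite -H1 pdth_dx (raddfD W) /=; apply/funext => M; rewrite !fctE; ring.
have e3 : pdth 0 (W f) = umul k.+1 f - W (pdth 0 f) by rewrite -H0 addrK.
rewrite e1 e2 e3 (raddfB (@dx R)) /= dx_cmul dx_umul !sub0r !(raddfN (umul 0)) /=.
rewrite -[in cinf_derive _]cinf_cstE cinf_derive_cst.
by apply/funext => M; rewrite /cmul !fctE /cmul -natr1; ring.
Qed.

Lemma pdth1_wop k f : h (wop k.+1 f) + wop k.+1 (h f) = cmul (k.+3)%:R (umul k f).
Proof.
elim: k f => [|k IH] f.
  rewrite !wop1 !raddfD /= !pdth_umul !pdth_tmul /= !sub0r !(raddfB (umul 0)) !(raddfN (umul 1)) /=.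
  by apply/funext => M; rewrite /cmul !fctE; ring.
exact: (pdth1_step_wop IH (pdth0_wop k.+1)).
Qed.

Lemma pdth1_step_yop (W : {additive hA -> hA}) k :
  (forall f, h (W f) - W (h f) = cmul (k%:R - 1) (tmul k f)) ->
  (forall f, pdth 0 (W f) - W (pdth 0 f) = tmul k.+1 f) ->
  forall f, let W' g := dx (W g) - W (dx g) in
    h (W' f) - W' (h f) = cmul (k.+1%:R - 1) (tmul k.+1 f).
Proof.
move=> H1 H0 f /=.
have e1 : h (W f) = cmul (k%:R - 1) (tmul k f) + W (h f) by rewrite -H1 subrK.
have e2 : h (W (dx f)) = cmul (k%:R - 1) (tmul k (dx f)) + W (dx (h f)) + W (pdth 0 f).
  by rewrite -H1 pdth_dx (raddfD W) /=; apply/funext => M; rewrite !fctE; ring.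
have e3 : pdth 0 (W f) = tmul k.+1 f + W (pdth 0 f) by rewrite -H0 subrK.
rewrite (raddfB h) /= pdth_dx /= e1 e2 e3 (raddfD (@dx R)) /= dx_cmul dx_tmul.
rewrite raddfB /= -[in cinf_derive _]cinf_cstE cinf_derive_cst.
rewrite -[X in 0 - cinf_derive X](cinf_cstE R 1) cinf_derive_cst.
by apply/funext => M; rewrite /cmul !fctE /cmul -natr1; ring.
Qed.

Lemma pdth1_yop k f : h (yop k f) - yop k (h f) = cmul (k%:R - 1) (tmul k f).
Proof.
elim: k f => [|k IH] f.
  rewrite /= !pdth_tmul /= !sub0r !(raddfB (tmul 0)) /=.
  by apply/funext => M; rewrite /cmul !fctE; ring.
exact: (pdth1_step_yop IH (pdth0_yop k)).
Qed.

(** The second homotopy: h = d/dtheta^1 is the contraction with the dilation of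
    the line, of which every generator is an eigenvector; the eigenvalue on a
    monomial is std - sup + 2 jet. *)
Lemma h_del f : h (del f) + del (h f) = wdiag eul_u eul_th f.
Proof.
move: f; have [_ _ cd ud td] := isder_del R; have [_ _ ch uh th] := isder_pdth1 R.
have [_ sd _] := wshift_del R.
apply: (der_anticomm (isder_pdth1 R) (isder_del R) (isder_diag _ eul_u eul_th)
  (@wshift_pdth R std_u std_th 1) sd) => [|f|k f|k f].
- by apply: wshift_eq (wshift_diag _ _ _ _ _) _.
- by rewrite add0r.
- rewrite raddf0 !addr0; case: k => [|k]; first by rewrite raddf0 addr0.
  by rewrite pdth1_wop.
- have -> : del ((if k == 1%N then id else fun=> 0) f) = (if k == 1%N then id else fun=> 0) (del f).
    by case: eqP => // _; rewrite raddf0.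
  by rewrite addrK pdth1_yop /eul_th intrD mulrN1z.
Qed.

Definition ninv (j : int) : cinf R :=
  if j is Posz n.+1 then cinf_cst n.+1%:R^-1 else 0.
(** The homotopy normalized by the number of factors u^s, theta^(s+1), s >= 1. *)
Definition invdR f : hA := hty (diag ninv jet_u form_th f).

Lemma invdRB : addop invdR. Proof. by move=> f g; rewrite /invdR !raddfB. Qed.
HB.instance Definition _ := GRing.isZmodMorphism.Build hA hA invdR invdRB.

Lemma wshift_invdR (a b : nat -> int) (r : int) : (forall k, b k.+2 = a k + r) -> wshift a b (- r) invdR.
Proof.
move=> H; have := wshift_comp (@wshift_hty R _ _ _ H) (wshift_diag ninv a b jet_u form_th).
by rewrite add0r.
Qed.

(** The factors other than u^s, theta^(s+1), s >= 1, are theta and theta^1; their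
    total degree is at most 1. *)
Lemma wt_form_gt0 M : (1 < stdeg M)%N -> exists n, wt jet_u form_th M = n.+1%:Z.
Proof.
case: M => m S d1; have [S2|/hasPn S2] := boolP (has (fun s => 1 < s)%N S).
  have [s sS s1] := hasP S2.
  exists (size m + \sum_(t <- (S `\ s)%fset) (1 < t)%N)%N.
  rewrite (wtDth _ _ _ sS) /form_th s1 /wt /= big_const_seq count_predT iter_addr_0.
  by rewrite -(raddf_sum Posz) /= natz -!PoszD add1n.
have [m0|[k km]] : m = mset0 \/ exists k, k \in m.
    have [->|] := eqVneq m mset0; [by left|move=> m0; right].
    case E : (enum_mset m) => [|k l]; last by exists k; rewrite -[_ \in _]/(k \in enum_mset m) E inE eqxx.
    by move: m0; rewrite -(seq_mset_id m) E => /eqP[]; apply/msetP => x; rewrite mset_seqE mset0E.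
  move: d1; rewrite m0 /stdeg /= enum_mset0 big_nil add0n.
  suff H : (\sum_(s <- S) s <= 1)%N by rewrite ltnNge H.
  have [S1|S1] := boolP (1%N \in S).
    rewrite (big_fsetD1 _ S1) /= big_seq big1 ?addn0// => s.
    by rewrite in_fsetD1 => /andP[s1 /S2]; case: s s1 => [|[|]].
  rewrite big_seq big1// => s sS; have := S2 _ sS; case: s sS => [|[|]]//.
  by move=> e; rewrite e in S1.
exists (size (m `\ k)%mset + \sum_(t <- S) (1 < t)%N)%N.
rewrite (wtD _ _ _ km) /wt /= big_const_seq count_predT iter_addr_0 /jet_u.
by rewrite -(raddf_sum Posz) /= natz -!PoszD add1n.
Qed.

(** Poincare lemma.  The cohomology of dR is carried by the functions of u, theta
    and theta^1, of degree at most 1. *)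
Lemma invdR_dR f d : proj std_u std_th d%:Z f = f -> (1 < d)%N -> dR f = 0 -> dR (invdR f) = f.
Proof.
move=> fd d1 f0; have dc (c : cinf R) g : dR (cmul c g) = cmul c (dR g).
  by have [_ _ cd _ _] := isder_dR R; rewrite cd raddf0 add0r.
have s0 : wshift jet_u form_th 0 dR by apply: wshift_dR.
have := dR_hty (diag ninv jet_u form_th f).
rewrite (diag_comm _ s0 dc) f0 raddf0 raddf0 addr0 -/(invdR f) => ->.
apply/funext => M; rewrite /wdiag /diag mulrA.
rewrite -fd proj_stdeg; case: eqP => [[Md]|_]; last by rewrite mulr0.
have [|n ->] := @wt_form_gt0 M; first by rewrite Md.
by rewrite /ninv [X in X * _]mulrC -pmulrn cinf_natV ?mul1r.
Qed.

End Homotopies.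

(** * Acyclicity of the pencil *)

Section Pencil.
Variable R : realType.
Local Notation hA := (hatA R).
Implicit Types (f g : hA) (c : cinf R) (M : monomial) (T D E : hA -> hA).
Implicit Types (x y z : nat -> hA) (i j k n : nat) (p d m : int).
Local Notation dR := (@dR R). Local Notation dbase := (@dbase R).
Local Notation D1 := (@D1 R). Local Notation DD2 := (@DD2 R).
Local Notation del := (@del R). Local Notation dup := (@dup R).
Local Notation invdR := (@invdR R). Local Notation twice_u := (twice_u R).
Local Notation h := (@pdth R 1).
Local Notation pm := (proj jet_u jet_th).

Definition bihom p d f := proj sup_u sup_th p f = f /\ proj std_u std_th d f = f.

Lemma bihomB p d f g : bihom p d f -> bihom p d g -> bihom p d (f - g).
Proof. by move=> [e1 e2] [e3 e4]; split; rewrite raddfB /= ?e1 ?e2 ?e3 ?e4. Qed.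

Lemma bihom0 p d : bihom p d 0.
Proof. by split; rewrite raddf0. Qed.

Lemma bihomN p d f : bihom p d f -> bihom p d (- f).
Proof. by rewrite -[- f]sub0r; apply: bihomB; apply: bihom0. Qed.

Lemma bihomD p d f g : bihom p d f -> bihom p d g -> bihom p d (f + g).
Proof. by move=> H1 H2; rewrite -[g]opprK; apply: bihomB => //; apply: bihomN. Qed.

Lemma bihom_shift rp rd T p d p' d' f : wshift sup_u sup_th rp T -> wshift std_u std_th rd T ->
  p' = p + rp -> d' = d + rd -> bihom p d f -> bihom p' d' (T f).
Proof. by move=> H1 H2 -> -> [e1 e2]; split; rewrite (H1, H2) (e1, e2). Qed.

Lemma bihom_proj p d a b m f : bihom p d f -> bihom p d (proj a b m f).
Proof. by move=> [e1 e2]; split; rewrite projC (e1, e2). Qed.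

Lemma bihom_cmul p d c f : bihom p d f -> bihom p d (cmul c f).
Proof.
by apply: bihom_shift (@wshift_cmul R _ _ c) (@wshift_cmul R _ _ c) _ _; rewrite addr0.
Qed.

Lemma bihom_D1 p d f : bihom (p - 1) (d - 1) f -> bihom p d (D1 f).
Proof. by apply: bihom_shift (@wshift_D1_p R) (@wshift_D1_d R) _ _; rewrite subrK. Qed.

Lemma bihom_DD2 p d f : bihom (p - 1) (d - 1) f -> bihom p d (DD2 f).
Proof. by apply: bihom_shift (@wshift_DD2_p R) (@wshift_DD2_d R) _ _; rewrite subrK. Qed.

Lemma bihom_invdR p d f : bihom p d f -> bihom (p - 1) (d - 1) (invdR f).
Proof.
apply: bihom_shift (wshift_invdR (r := 1) _) (wshift_invdR (r := 1) _) _ _ => // k.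
by rewrite /std_u /std_th; lia.
Qed.

(** A polynomial in lambda is a sequence of coefficients vanishing from some
    index on.  On such sequences [mulv] is the multiplication by v = 2u - lambda,
    [pencil] is DD2 - lambda D1, and [cseq f] is the constant polynomial f. *)
Definition mulv x i : hA := cmul twice_u (x i) - (if i is j.+1 then x j else 0).
Definition pencil x i : hA := DD2 (x i) - (if i is j.+1 then D1 (x j) else 0).
Definition bounded n x := forall i, (n <= i)%N -> x i = 0.
Definition cseq f i : hA := if i is 0 then f else 0.

Lemma pencilB x y i : pencil (fun i => x i - y i) i = pencil x i - pencil y i.
Proof.
rewrite /pencil raddfB; case: i => [|i]; first by rewrite !subr0.
by rewrite raddfB /= opprB opprD addrACA addrCA [LHS]addrA; apply/funext=> M; rewrite !fctE; ring.
Qed.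

Lemma pencil_pencil x i : pencil (pencil x) i = 0.
Proof.
rewrite /pencil; case: i => [|i]; first by rewrite !subr0 DD2_DD2.
rewrite !raddfB /= DD2_DD2; have := D1_DD2 (x i); move/eqP; rewrite addr_eq0 => /eqP ->.
by case: i => [|i]; rewrite ?raddf0 ?D1_D1; apply/funext=> M; rewrite !fctE ?hatA0E; ring.
Qed.

Lemma bihom_pencil p d x i : (forall i, bihom (p - 1) (d - 1) (x i)) -> bihom p d (pencil x i).
Proof.
move=> H; apply: bihomB; first exact: bihom_DD2.
by case: i => [|i]; [exact: bihom0|exact: bihom_D1].
Qed.

Lemma bounded_pencil n x : bounded n x -> bounded n.+1 (pencil x).
Proof.
by move=> xn [//|i] ni; rewrite /pencil !xn ?(raddf0, subr0)//; apply: leqW.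
Qed.

Lemma boundedW n n' x : (n <= n')%N -> bounded n x -> bounded n' x.
Proof. by move=> nn H i ni; apply: H; apply: leq_trans ni. Qed.

Lemma boundedB n x y : bounded n x -> bounded n y -> bounded n (fun i => x i - y i).
Proof. by move=> H1 H2 i ni; rewrite H1// H2// subrr. Qed.

(** v has leading coefficient -1 in lambda, so it is not a zero divisor. *)
Lemma mulv_inj n x : bounded n x -> (forall i, mulv x i = 0) -> forall i, x i = 0.
Proof.
move=> xn x0; suff H k i : (n <= i + k)%N -> x i = 0.
  by move=> i; apply: (H n); rewrite leq_addl.
elim: k i => [|k IH] i; first by rewrite addn0; exact: xn.
rewrite addnS -addSn => /IH e; have := x0 i.+1.
by rewrite /mulv e raddf0 sub0r => /eqP; rewrite oppr_eq0 => /eqP.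
Qed.

(** Division by v: [ev n] is the value at lambda = 2u and [quov n] the quotient, n
    being a bound for the support. *)
Definition ev n x : hA := \sum_(j < n) cmul (twice_u ^+ j) (x j).
Definition quov n x i : hA := - \sum_(j < n) cmul (twice_u ^+ j) (x (i + j).+1).

Lemma mulv_quov n x i : bounded n x -> mulv (quov n x) i = x i - cseq (ev n x) i.
Proof.
move=> xn; have T k : x k = \sum_(j < n) cmul (twice_u ^+ j) (x (k + j)%N) -
    \sum_(j < n) cmul (twice_u ^+ j.+1) (x (k + j).+1).
  have <- : \sum_(j < n.+1) cmul (twice_u ^+ j) (x (k + j)%N) =
      \sum_(j < n) cmul (twice_u ^+ j) (x (k + j)%N).
    by rewrite big_ord_recr /= (xn (k + n)%N) ?leq_addl// raddf0 addr0.
  rewrite big_ord_recl addn0 expr0 cmul1 -addrA -[LHS]addr0; congr (_ + _).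
  apply/esym/eqP; rewrite subr_eq0; apply/eqP.
  by apply: eq_bigr => j _; rewrite /= /bump /= add1n addnS.
rewrite /mulv /quov raddfN raddf_sum /=.
under eq_bigr do rewrite cmulA -exprS.
case: i => [|i].
  by rewrite subr0 {1}(T 0%N) /= /ev addrAC subrr sub0r.
by rewrite opprK subr0 [RHS](T i.+1) addrC.
Qed.

Lemma ev_mulv n x : bounded n x -> ev n.+1 (mulv x) = 0.
Proof.
have H k : ev k.+1 (mulv x) = cmul (twice_u ^+ k.+1) (x k).
  elim: k => [|k IH]; first by rewrite /ev big_ord1 /= /mulv subr0 expr0 cmul1.
  by rewrite /ev big_ord_recr -/(ev _ _) IH /= /mulv raddfB /= cmulA -exprSr addrC subrK.
by move=> xn; rewrite H xn// raddf0.
Qed.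

Lemma ev_cseq n f : ev n.+1 (cseq f) = f.
Proof.
by rewrite /ev big_ord_recl /= expr0 cmul1 big1 ?addr0// => j _; rewrite raddf0.
Qed.

Lemma evD n x y : ev n (fun i => x i + y i) = ev n x + ev n y.
Proof. by rewrite /ev -big_split; apply: eq_bigr => j _; rewrite raddfD. Qed.

Lemma ev_T n x (T : {additive hA -> hA}) : (forall c f, T (cmul c f) = cmul c (T f)) ->
  T (ev n x) = ev n (fun i => T (x i)).
Proof.
move=> Tc; rewrite /ev raddf_sum; apply: eq_bigr => j _.
by rewrite /= Tc.
Qed.

Lemma quov_T n x i (T : {additive hA -> hA}) : (forall c f, T (cmul c f) = cmul c (T f)) ->
  T (quov n x i) = quov n (fun i => T (x i)) i.
Proof.
move=> Tc; rewrite /quov raddfN raddf_sum; congr (- _); apply: eq_bigr => j _.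
by rewrite /= Tc.
Qed.

Lemma bounded_quov n x : bounded n x -> bounded n (quov n x).
Proof.
move=> xn i ni; rewrite /quov big1 ?oppr0// => j _.
by rewrite xn ?raddf0//; apply: leqW; apply: leq_trans (leq_addr _ _).
Qed.

Lemma dR_cmul c f : dR (cmul c f) = cmul c (dR f).
Proof. by have [_ _ cd _ _] := isder_dR R; rewrite cd raddf0 add0r. Qed.

Lemma del_cmul c f : del (cmul c f) = cmul c (del f).
Proof. by have [_ _ cd _ _] := isder_del R; rewrite cd raddf0 add0r. Qed.

Lemma proj_cmul a b m c f : proj a b m (cmul c f) = cmul c (proj a b m f).
Proof. exact: wshift_proj0 (@wshift_cmul R a b c) m f. Qed.

Lemma proj_ev a b m n x : proj a b m (ev n x) = ev n (fun i => proj a b m (x i)).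
Proof. by apply: ev_T => c f; exact: proj_cmul. Qed.

Lemma proj_quov a b m n x i : proj a b m (quov n x i) = quov n (fun i => proj a b m (x i)) i.
Proof. by apply: quov_T => c f; exact: proj_cmul. Qed.

Lemma bihom_quov p d n x i : (forall i, bihom p d (x i)) -> bihom p d (quov n x i).
Proof.
move=> H; split; rewrite proj_quov; congr (quov n _ i); apply/funext => j; by have [] := H j.
Qed.

Lemma bihom_ev p d n x : (forall i, bihom p d (x i)) -> bihom p d (ev n x).
Proof.
move=> H; split; rewrite proj_ev; congr (ev n _); apply/funext => j; by have [] := H j.
Qed.

Lemma pencil_split x i : pencil x i = mulv (fun i => dR (x i) + dbase (x i)) i + del (x i) + dup (x i).
Proof.
by rewrite /pencil DD2_split /mulv -/(D1 (x i)); case: i => [|i]; rewrite ?subr0//;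
  rewrite -/(D1 (x i)) addrAC [in RHS]addrAC; apply/funext=> M; rewrite !fctE; ring.
Qed.

Lemma pm_dR m f : pm m (dR f) = dR (pm (m + 1) f).
Proof. by rewrite -(@wshift_dR R jet_u jet_th (- 1)) ?addrK// => k; rewrite /jet_u /jet_th; lia. Qed.
Lemma pm_dbase m f : pm m (dbase f) = dbase (pm m f).
Proof. exact: wshift_proj0 (@wshift_dbase R jet_u jet_th) m f. Qed.
Lemma pm_del m f : pm m (del f) = del (pm m f).
Proof. by have [_ _ H] := wshift_del R; exact: wshift_proj0 H m f. Qed.
Lemma pm_dup m f : pm m (dup f) = dup (pm (m - 1) f).
Proof. by rewrite -(@wshift_dup R jet_u jet_th) /jet_u /jet_th; congr (pm _ _); lia. Qed.
Lemma pm_invdR m f : pm m (invdR f) = invdR (pm (m - 1) f).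
Proof.
rewrite -(@wshift_invdR R jet_u jet_th (- 1)); first by congr (pm _ _); lia.
by move=> k; rewrite /jet_u /jet_th; lia.
Qed.
Lemma pm_h m f : pm m (h f) = h (pm m f).
Proof. by rewrite -(@wshift_pdth R jet_u jet_th 1) /jet_th oppr0 addr0. Qed.

Lemma pm_pencil m x i : pm m (pencil x i) =
  mulv (fun i => dR (pm (m + 1) (x i)) + dbase (pm m (x i))) i +
  del (pm m (x i)) + dup (pm (m - 1) (x i)).
Proof.
rewrite pencil_split (raddfD (pm m)) /= (raddfD (pm m)) /= pm_del pm_dup; congr (_ + _ + _).
rewrite /mulv raddfB /= proj_cmul raddfD /= pm_dR pm_dbase; congr (_ - _).
by case: i => [|i]; rewrite ?raddf0// raddfD /= pm_dR pm_dbase.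
Qed.

Definition jetge m f := forall k : int, k < m -> pm k f = 0.

Lemma wt_eul M : wt eul_u eul_th M = wt std_u std_th M - wt sup_u sup_th M + wt jet_u jet_th M + wt jet_u jet_th M.
Proof.
rewrite /wt.
have -> : \sum_(k <- M.1) eul_u k = \sum_(k <- M.1) std_u k - \sum_(k <- M.1) sup_u k
   + \sum_(k <- M.1) jet_u k + \sum_(k <- M.1) jet_u k.
  by rewrite -sumrB -!big_split; apply: eq_bigr => k _; rewrite /eul_u /std_u /sup_u /jet_u /=; lia.
have -> : \sum_(k <- M.2) eul_th k = \sum_(k <- M.2) std_th k - \sum_(k <- M.2) sup_th k
   + \sum_(k <- M.2) jet_th k + \sum_(k <- M.2) jet_th k.
  by rewrite -sumrB -!big_split; apply: eq_bigr => k _; rewrite /eul_th /std_th /sup_th /jet_th /=; lia.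
lia.
Qed.

Lemma proj_supp a b m f M : proj a b m f = f -> f M != 0 -> wt a b M = m.
Proof. by move=> <-; rewrite /proj; have [->|_] := eqVneq (wt a b M) m; rewrite ?eqxx. Qed.

Lemma wdiag_eul p d m (c0 : int) f : bihom p d f -> pm m f = f -> c0 = d - p + m + m ->
  wdiag eul_u eul_th f = cmul c0%:~R f.
Proof.
move=> [fp fd] fm ->; apply/funext => M; rewrite /wdiag /diag /cmul.
have [->|f0] := eqVneq (f M) 0; first by rewrite !mulr0.
congr (_%:~R * _); rewrite wt_eul.
by rewrite (proj_supp fp f0) (proj_supp fd f0) (proj_supp fm f0).
Qed.

Lemma ninvK (c0 : int) f : (f = 0 \/ 0 < c0) -> cmul (@ninv R c0) (cmul c0%:~R f) = f.
Proof.
case=> [->|]; first by rewrite !raddf0.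
case: c0 => [[|n]|n] // _; rewrite cmulA /ninv.
by rewrite -pmulrn cinf_natV ?cmul1.
Qed.

(** The eigenvalue in [h_del] is positive in bidegree (p, d), so that h is there a
    contracting homotopy of del. *)
Definition eulpos p d := forall f m, bihom p d f -> pm m f = f -> f = 0 \/ 0 < d - p + m + m.

(** The component of lowest jet number of a cocycle can be made independent of
    lambda: it is dR-closed, and its difference to its value at lambda = 2u is a
    multiple of v, hence in the image of v dR. *)
Lemma pencil_lead_const p (d : nat) m n z : (1 < d)%N ->
  (forall i, bihom p d (z i)) -> bounded n z -> (forall i, jetge m (z i)) ->
  (forall i, pencil z i = 0) ->
  exists y, [/\ forall i, bihom (p - 1) (d%:Z - 1) (y i), bounded n y,
    forall i, jetge m (z i - pencil y i) &
    exists f, [/\ bihom p d f, pm m f = f, dR f = 0 &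
      forall i, pm m (z i - pencil y i) = cseq f i]].
Proof.
move=> d1 zh zn zm z0.
pose a i := pm m (z i); pose w i := quov n a i; pose y i := invdR (w i).
have a0 i : dR (a i) = 0.
  apply: (@mulv_inj n (fun i => dR (a i))) => [j nj|j]; first by rewrite /a zn// !raddf0.
  have := congr1 (pm (m - 1)) (z0 j); rewrite pm_pencil raddf0.
  rewrite !zm; [|lia|lia]; rewrite !raddf0 !addr0 => <-.
  congr (mulv _ j); apply/funext => k.
  by rewrite [pm (m - 1) _]zm ?raddf0 ?addr0 ?subrK//; lia.
have an : bounded n a by move=> i ni; rewrite /a zn// raddf0.
have ah i : bihom p d (a i) by apply: bihom_proj.
have wh i : bihom p d (w i) by apply: bihom_quov.
have wm i : pm m (w i) = w i.
  by rewrite /w proj_quov; congr (quov n _ i); apply/funext => j; rewrite /a proj_proj eqxx.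
have w0 i : dR (w i) = 0.
  rewrite /w quov_T; last exact: dR_cmul.
  by rewrite /quov big1 ?oppr0// => j _; rewrite /= a0 raddf0.
have dy i : dR (y i) = w i by have [_ e] := wh i; exact: (invdR_dR e d1 (w0 i)).
have ym i : pm (m + 1) (y i) = y i by rewrite pm_invdR addrK wm.
have ym0 (k : int) i : k != m + 1 -> pm k (y i) = 0.
  by move=> km; rewrite -ym proj_proj (negPf km).
have mulv0 i : mulv (fun=> 0) i = 0 by rewrite /mulv raddf0; case: i => [|i]; rewrite subr0.
exists y; split=> [i|i ni|i k km|].
- exact: bihom_invdR.
- by rewrite /y /w (bounded_quov an)// raddf0.
- rewrite raddfB /= zm// pm_pencil !ym0; [|lia|lia].
  rewrite !raddf0 !addr0 (_ : (fun _ => _) = fun=> 0) ?mulv0 ?subr0//.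
  by apply/funext => j; rewrite !ym0 ?raddf0 ?addr0//; lia.
exists (ev n a); split.
- exact: bihom_ev.
- by rewrite proj_ev; congr (ev n _); apply/funext => j; rewrite /a proj_proj eqxx.
- by rewrite ev_T ?/ev; [rewrite big1// => j _; rewrite /= a0 raddf0|exact: dR_cmul].
- move=> i; rewrite raddfB /= pm_pencil !(ym0 _ i); [|lia|lia].
  rewrite !raddf0 !addr0 (_ : (fun _ => _) = w); last first.
    by apply/funext => j; rewrite ym dy ym0 ?raddf0 ?addr0//; lia.
  by rewrite mulv_quov// opprB addrC subrK.
Qed.

(** A cocycle whose lowest component f is independent of lambda and dR-closed.
    Evaluating the next component at lambda = 2u gives del f = 0, so the homotopy
    h removes f.  This creates v dbase y2, which is v times a dR-closed form and
    is removed in turn by y3. *)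
Lemma pencil_lead_kill p (d : nat) m n z f : (1 < d)%N -> eulpos p d ->
  (forall i, bihom p d (z i)) -> bounded n z -> (forall i, jetge m (z i)) ->
  (forall i, pencil z i = 0) ->
  bihom p d f -> pm m f = f -> dR f = 0 -> (forall i, pm m (z i) = cseq f i) ->
  exists y, [/\ forall i, bihom (p - 1) (d%:Z - 1) (y i), bounded 1 y &
    forall i, jetge (m + 1) (z i - pencil y i)].
Proof.
move=> d1 amp zh zn zm z0 fh fm f0 zf.
set c0 := d%:Z - p + m + m.
have df0 : del f = 0.
  have H i : mulv (fun i => dR (pm (m + 1) (z i)) + dbase (pm m (z i))) i + cseq (del f) i = 0.
    have := congr1 (pm m) (z0 i); rewrite pm_pencil raddf0 [pm (m - 1) _]zm; last by lia.
    rewrite raddf0 addr0 zf => <-; congr (_ + _).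
    by case: i => //= i; rewrite raddf0.
  have E : ev n.+1 (fun i => mulv (fun i => dR (pm (m + 1) (z i)) + dbase (pm m (z i))) i +
     cseq (del f) i) = 0 by rewrite /ev big1// => j _; rewrite H raddf0.
  move: E; rewrite evD ev_mulv ?ev_cseq ?add0r// => i ni.
  by rewrite zn// !raddf0 addr0.
(* c0 is the eigenvalue of del h on f; dR y3 = dbase y2. *)
pose y2 := cmul (ninv R c0) (h f); pose y3 := invdR (dbase y2).
have y2h : bihom (p - 1) (d%:Z - 1) y2.
  apply: bihom_cmul; apply: bihom_shift (@wshift_pdth R _ _ 1) (@wshift_pdth R _ _ 1) _ _ fh => //.
have y2m : pm m y2 = y2 by rewrite /y2 proj_cmul pm_h fm.
have dRy2 : dR y2 = 0.
  rewrite /y2 dR_cmul; have := h_dR f; rewrite f0 raddf0 add0r => ->.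
  exact: raddf0.
have dely2 : del y2 = f.
  rewrite /y2 del_cmul; have := h_del f; rewrite df0 raddf0 add0r => ->.
  by rewrite (wdiag_eul fh fm (erefl c0)) ninvK//; apply: amp.
have ey2h : bihom p d (dbase y2).
  apply: bihom_shift (@wshift_dbase R _ _) (@wshift_dbase R _ _) _ _ y2h; by rewrite /sup_th /std_th; lia.
have dRe : dR (dbase y2) = 0.
  by have := dR_dbase y2; rewrite dRy2 raddf0 addr0.
have dRy3 : dR y3 = dbase y2 by have [_ e] := ey2h; exact: (invdR_dR e d1 dRe).
have ey2m : pm m (dbase y2) = dbase y2 by rewrite pm_dbase y2m.
have y3m : pm (m + 1) y3 = y3 by rewrite /y3 pm_invdR addrK ey2m.
have pmy (k : int) : pm k (y2 - y3) = (if k == m then y2 else 0) - (if k == m + 1 then y3 else 0).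
  by rewrite raddfB /= -y2m -y3m !proj_proj.
have pma (k : int) i : pm k (cseq (y2 - y3) i) = cseq (pm k (y2 - y3)) i.
  by case: i => // i; rewrite raddf0.
exists (cseq (y2 - y3)); split=> [[|i]|[|i]|i k km] //.
- by apply: bihomB => //; apply: bihom_invdR.
- exact: bihom0.
rewrite raddfB /= pm_pencil !pma !pmy.
have [km1 [km2 [km3 km4]]] : (k == m + 1 = false) /\ (k + 1 == m + 1 = (k == m)) /\
   (k - 1 == m = false) /\ (k - 1 == m + 1 = false) by lia.
have F : (fun i => dR (pm (k + 1) (cseq (y2 - y3) i)) + dbase (pm k (cseq (y2 - y3) i))) = fun=> 0.
  apply/funext => -[|j]; rewrite /= ?raddf0 ?addr0//.
  rewrite !pmy km1 km2 subr0; have [->|_] := eqVneq k m.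
    rewrite (_ : (m + 1 == m) = false); last by lia.
    by rewrite sub0r raddfN /= dRy3 addNr.
  by rewrite ?subr0 raddf0 ?(addr0, subr0); case: ifP; rewrite ?dRy2 ?raddf0.
rewrite F km1 km3 km4 !subr0.
have -> : mulv (fun=> 0) i = 0 by rewrite /mulv raddf0; case: i => [|i]; rewrite subr0.
have -> : dup (cseq 0 i) = 0 by case: i => [|i]; exact: raddf0.
rewrite add0r addr0; have [->|k0] := eqVneq k m.
  by rewrite zf; case: i => [|i] /=; rewrite ?(dely2, subrr, raddf0, addr0).
rewrite zm; last by lia.
by case: i => [|i] /=; rewrite ?(raddf0, subr0, addr0).
Qed.

Lemma wt_ge0 a b M : (forall k, 0 <= a k) -> (forall k, 0 <= b k) -> 0 <= wt a b M.
Proof. by move=> Ha Hb; rewrite addr_ge0// sumr_ge0. Qed.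

Lemma jetge0 f : jetge 0 f.
Proof.
move=> k k0; apply/funext => M; rewrite /proj ifN//; apply: contraTneq k0 => <-.
by rewrite -leNgt wt_ge0.
Qed.

Lemma jetge_big p (d : nat) f : bihom p d f -> jetge (d%:Z + 1) f -> f = 0.
Proof.
move=> [_ fd] H; apply/funext => M; apply/eqP; apply: contraT => fM.
have Md : wt std_u std_th M = d.
  exact: proj_supp fd fM.
have Mm : wt jet_u jet_th M < d%:Z + 1.
  rewrite ltzD1 -Md /wt lerD ?ler_sum// => k _; rewrite /jet_u /std_u /jet_th /std_th; lia.
by have := congr1 (fun g : hA => g M) (H _ Mm); rewrite /proj eqxx => e; rewrite e eqxx in fM.
Qed.

(** Each round of [pencil_lead_const] and [pencil_lead_kill] raises the lowest jet
    number, which is bounded by the standard degree d. *)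
Lemma pencil_acyclic p (d : nat) n z : (1 < d)%N -> eulpos p d ->
  (forall i, bihom p d (z i)) -> bounded n z -> (forall i, pencil z i = 0) ->
  exists y n', [/\ forall i, bihom (p - 1) (d%:Z - 1) (y i), bounded n' y & forall i, z i = pencil y i].
Proof.
move=> d1 amp zh zn z0.
suff H k : forall n z, (forall i, bihom p d (z i)) -> bounded n z -> (forall i, pencil z i = 0) ->
    (forall i, jetge (d%:Z + 1 - k%:Z) (z i)) ->
    exists y n', [/\ forall i, bihom (p - 1) (d%:Z - 1) (y i), bounded n' y & forall i, z i = pencil y i].
  apply: (H d.+1 n z zh zn z0) => i; rewrite (_ : _ - _ = 0); last by lia.
  exact: jetge0.
elim: k {n z zh zn z0} => [|k IH] n z zh zn z0 zm.
  exists (fun=> 0), 0%N; split=> // i; first exact: bihom0.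
  rewrite (jetge_big (zh i)); last by have := zm i; rewrite subr0.
  by rewrite /pencil raddf0; case: i => [|i]; rewrite ?(raddf0, subr0, addr0).
set m := (_ - _) in zm.
have [y1 [y1h y1n z1m [f [fh fm f0 z1f]]]] := pencil_lead_const d1 zh zn zm z0.
pose z1 i := z i - pencil y1 i.
have z1h i : bihom p d (z1 i) by apply: bihomB => //; apply: bihom_pencil.
have z1n : bounded n.+1 z1 by apply: boundedB; [exact: boundedW zn|exact: bounded_pencil].
have z10 i : pencil z1 i = 0 by rewrite pencilB z0 pencil_pencil subr0.
have [y2 [y2h y2n z2m]] := pencil_lead_kill d1 amp z1h z1n z1m z10 fh fm f0 z1f.
pose z2 i := z1 i - pencil y2 i.
have [|||i|y3 [n3 [y3h y3n y3e]]] := IH (maxn n.+1 2) z2.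
- by move=> i; apply: bihomB => //; apply: bihom_pencil.
- apply: boundedB; first by apply: boundedW z1n; rewrite leq_maxl.
  by apply: boundedW (bounded_pencil y2n); rewrite leq_maxr.
- by move=> i; rewrite pencilB z10 pencil_pencil subr0.
- have := z2m i; rewrite (_ : m + 1 = d%:Z + 1 - k%:Z)//.
  by rewrite /m; lia.
exists (fun i => y1 i - (- y2 i - y3 i)), (maxn (maxn n 1) n3); split=> [i|i|i].
- by apply: bihomB => //; apply: bihomB => //; apply: bihomN.
- rewrite !geq_max => /andP[/andP[ni i1] i3].
  by rewrite y1n// y2n// y3n// !(oppr0, subr0).
- have y2N : pencil (fun i => - y2 i) i = - pencil y2 i.
    have := pencilB (fun=> 0) y2 i; rewrite (_ : (fun i => 0 - y2 i) = (fun i => - y2 i)); last first.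
      by apply/funext => j; rewrite sub0r.
    move=> ->; rewrite (_ : pencil (fun=> 0) i = 0) ?sub0r//.
    by rewrite /pencil raddf0; case: i => [|i]; rewrite ?(raddf0, subr0, addr0).
  rewrite (pencilB y1 (fun i => - y2 i - y3 i)) (pencilB (fun i => - y2 i) y3) y2N -y3e /z2 /z1.
  by apply/funext => M; rewrite !fctE; ring.
Qed.

(** The same filtration as for the pencil, with dR alone as leading part. *)
Lemma D1_acyclic p (d : nat) f : (1 < d)%N -> bihom p d f -> D1 f = 0 ->
  exists2 y, bihom (p - 1) (d%:Z - 1) y & f = D1 y.
Proof.
move=> d1 fh f0.
suff H k : forall f, bihom p d f -> D1 f = 0 -> jetge (d%:Z + 1 - k%:Z) f ->
    exists2 y, bihom (p - 1) (d%:Z - 1) y & f = D1 y.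
  apply: (H d.+1) => //; rewrite (_ : _ - _ = 0); last by lia.
  exact: jetge0.
elim: k {f fh f0} => [|k IH] f fh f0 fm.
  exists 0; first exact: bihom0.
  by rewrite (jetge_big fh) ?raddf0//; move: fm; rewrite subr0.
set m := (_ - _) in fm.
have pmA (j : int) g : pm j (D1 g) = dR (pm (j + 1) g) + dbase (pm j g).
  by rewrite raddfD /= pm_dR pm_dbase.
have a0 : dR (pm m f) = 0.
  have := congr1 (pm (m - 1)) f0; rewrite pmA raddf0 subrK => <-.
  by rewrite [pm (m - 1) f]fm ?raddf0 ?addr0//; lia.
have dG : dR (invdR (pm m f)) = pm m f.
  by have [_ e] := bihom_proj jet_u jet_th m fh; exact: (invdR_dR e d1 a0).
pose f1 := f - D1 (invdR (pm m f)).
have [|||y yh ye] := IH f1.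
- by apply: bihomB => //; apply: bihom_D1; apply: bihom_invdR; apply: bihom_proj.
- by rewrite raddfB /= f0 D1_D1 subr0.
- move=> j jm; rewrite raddfB /= pmA !pm_invdR addrK.
  have [->|jm'] := eqVneq j m.
    rewrite proj_proj eqxx dG proj_proj ifN; last by lia.
    by rewrite !raddf0 addr0 subrr.
  rewrite [pm j f]fm; last by rewrite /m in jm' *; lia.
  rewrite !proj_proj (negPf jm') ifN; last by rewrite /m in jm' *; lia.
  by rewrite !raddf0 addr0 subr0.
exists (invdR (pm m f) + y).
  by apply: bihomD => //; apply: bihom_invdR; apply: bihom_proj.
by rewrite raddfD /= -ye addrC subrK.
Qed.

End Pencil.

(** * Passage to local functionals *)

Section Quotient.
Variable R : realType.
Local Notation hA := (hatA R).
Implicit Types (f g : hA) (c : cinf R) (M : monomial) (X Y : nat -> hA -> hA).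
Local Notation dR := (@dR R). Local Notation dbase := (@dbase R).
Local Notation D1 := (@D1 R). Local Notation DD2 := (@DD2 R).
Local Notation yop := (@yop R). Local Notation xop := (@xop R).

Lemma proj_neg j f : j < 0 -> proj std_u std_th j f = 0.
Proof.
move=> j0; apply/funext => M; rewrite proj_stdeg ifN//.
by apply: contraTneq j0 => <-.
Qed.

Lemma pdu_big (d : nat) f s : proj std_u std_th d f = f -> (d < s)%N -> pdu s f = 0.
Proof.
case: s => // s fd ds; rewrite -fd -wshift_pduS proj_neg// /std_u; lia.
Qed.

Lemma pdth_big (d : nat) f s : proj std_u std_th d f = f -> (d < s)%N -> pdth s f = 0.
Proof. by move=> fd ds; rewrite -fd -wshift_pdth proj_neg// /std_th; lia. Qed.

(** One has [d/du^(s+1), dx] = d/du^s, and likewise for theta.  Hence, if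
    dx f = 0 and f involves no generator of index s + 1, then it involves none of
    index s; start above the degree of f. *)
Lemma dx_inj (d : nat) f : (0 < d)%N -> proj std_u std_th d f = f -> dx f = 0 -> f = 0.
Proof.
move=> d0 fd f0.
have H k s : (d < s + k)%N -> pdu s f = 0 /\ pdth s f = 0.
  elim: k s => [|k IH] s; first by rewrite addn0 => ds; rewrite (pdu_big fd)// (pdth_big fd).
  rewrite addnS -addSn => /IH[e1 e2]; split.
    by have := pdu_dx s.+1 f; rewrite f0 e1 !raddf0 add0r.
  by have := pdth_dx s.+1 f; rewrite f0 e2 !raddf0 add0r.
apply: (hatA_mulrIn d0); rewrite (euler fd) big1// => j _.
have [|-> ->] := H d j.+1; first by rewrite addSn ltnS leq_addl.
by rewrite !raddf0 !mul0rn addr0.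
Qed.

Lemma sum_fin (n N : nat) (F : nat -> hA) M : (forall s, (n <= s)%N -> F s = 0) ->
  (n <= N)%N -> \sum_(s < N) F s M = \sum_(s < n) F s M.
Proof.
move=> F0 nN; rewrite (big_ord_widen N (fun s => F s M) nN) [RHS]big_mkcond.
by apply: eq_bigr => s _; case: ltnP => // /F0 ->.
Qed.

Lemma fsum_fin n (F : nat -> hA) : (forall s, ordge s (F s)) ->
  (forall s, (n <= s)%N -> F s = 0) -> fsum F = \sum_(s < n) F s.
Proof.
move=> Fs F0; apply/funext => M; rewrite hatA_sumE.
rewrite (fsumW Fs (n := maxn n (stdeg M).+1)) ?leq_maxr//.
by apply: sum_fin => //; rewrite leq_maxl.
Qed.

Lemma lsum_fin n (F : nat -> hA) : summable F ->
  (forall s, (n <= s)%N -> F s = 0) -> lsum F = \sum_(s < n) F s.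
Proof.
move=> Fs F0; apply/funext => M; rewrite hatA_sumE.
rewrite (lsumW Fs (n := maxn n (stdeg M + 2))) ?leq_maxr//.
by apply: sum_fin => //; rewrite leq_maxl.
Qed.

Lemma intF_dx f : intF (dx f) = 0.
Proof. by rewrite -[RHS](raddf0 (@intF R)); apply/intF_eq; exists f; rewrite subr0. Qed.

Lemma intF_eq0 f : intF f = 0 -> exists g, f = dx g.
Proof.
rewrite -[RHS](raddf0 (@intF R)) => /intF_eq[g e]; exists g.
by rewrite -e subr0.
Qed.

(** Modulo dx, the operator (-dx)^s moves to the other factor, where it turns the
    multiplication by X into that by dx^s X. *)
Lemma intF_ibp X s k g : (forall k, addop (X k)) ->
  (forall k f, dx (X k f) = X k.+1 f + X k (dx f)) ->
  intF (X k (iter s (@mdx R) g)) = intF (X (k + s)%N g).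
Proof.
move=> aX cX; elim: s g => [|s IH] g; first by rewrite addn0.
rewrite iterSr IH /mdx (addopN (aX _)) addnS.
have -> : X (k + s).+1 g = dx (X (k + s)%N g) - X (k + s)%N (dx g) by rewrite cX addrK.
by rewrite raddfB /= intF_dx sub0r raddfN.
Qed.

(** Integration by parts turns the variational derivatives of the Schouten
    bracket into the full derivation with characteristics X 0 and Y 0. *)
Lemma intF_jetder X Y (d : nat) f : proj std_u std_th d f = f ->
  (forall k, addop (X k)) -> (forall k, addop (Y k)) ->
  (forall k g, ordge k.-1 (X k g)) -> (forall k g, ordge k.-1 (Y k g)) ->
  (forall k f, dx (X k f) = X k.+1 f + X k (dx f)) ->
  (forall k f, dx (Y k f) = Y k.+1 f + Y k (dx f)) ->
  intF (X 0%N (delta_u f) + Y 0%N (delta_th f)) = intF (jetder X Y f).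
Proof.
move=> fd aX aY oX oY cX cY.
have iter0 s : iter s (@mdx R) 0 = 0 by exact: (raddf0 (iter s (@mdx R))).
rewrite /delta_u /delta_th /jetder.
rewrite (@fsum_fin d.+1) ?(@fsum_fin d.+1) ?(@lsum_fin d.+1); first last.
- by move=> s ds; rewrite (pdu_big fd)// iter0.
- by move=> s; exact: ordge_iter.
- by move=> s ds; rewrite (pdth_big fd)// iter0.
- by move=> s; exact: ordge_iter.
- by move=> s ds; rewrite (pdu_big fd)// (pdth_big fd)// (addop0 (aX s)) (addop0 (aY s)) addr0.
- by move=> s M Ms; rewrite fctE oX// oY// addr0.
have sumX (Z : hA -> hA) (F : nat -> hA) : addop Z ->
    intF (Z (\sum_(s < d.+1) F s)) = \sum_(s < d.+1) intF (Z (F s)).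
  move=> aZ; elim: (d.+1) => [|n IH]; first by rewrite !big_ord0 (addop0 aZ) raddf0.
  by rewrite !big_ord_recr /= (addopD aZ) raddfD /= IH.
rewrite raddfD /= (sumX (X 0%N) (fun s => iter s (@mdx R) (pdu s f)))//.
rewrite (sumX (Y 0%N) (fun s => iter s (@mdx R) (pdth s f)))// -big_split raddf_sum; apply: eq_bigr => s _ /=.
by rewrite !intF_ibp// raddfD.
Qed.

Lemma amulDl f f' g : amul (f + f') g = amul f g + amul f' g.
Proof.
apply/funext => M; rewrite /amul !fctE.
rewrite !(fsbig_finite _ _ (finite_msub M.1)) -big_split /=; apply: eq_bigr => m _.
by rewrite -big_split; apply: eq_bigr => S _; rewrite /= mulrDl mulrDr.
Qed.

Lemma amul_cmull c f g : amul (cmul c f) g = cmul c (amul f g).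
Proof.
apply/funext => M; rewrite /amul /cmul.
rewrite !(fsbig_finite _ _ (finite_msub M.1)) mulr_sumr /=; apply: eq_bigr => m _.
by rewrite mulr_sumr; apply: eq_bigr => S _; rewrite -[c * _ * _]mulrA mulrCA.
Qed.

Lemma amul0l g : amul 0 g = 0.
Proof. by apply: (addIr (amul 0 g)); rewrite add0r -amulDl add0r. Qed.

Lemma amul_coef c f : amul (coef c) f = cmul c f.
Proof.
apply/funext => -[m S]; rewrite amul_mono /= msub0set fsub0set /= fsetD0.
rewrite /inversions big_seq_fset0 expr0 mul1r /cmul; congr (c * f (_, _)).
by apply/msetP => x; rewrite msetE2 mset0E subn0.
Qed.

Lemma thvarE s : thvar R s = tmul s (one R).
Proof.
apply/funext => -[m S]; rewrite tmulE /thvar /one /mono /= !xpair_eqE.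
have [sS|sS] := boolP (s \in S); last first.
  rewrite (_ : (S == _) = false) ?andbF//; apply: contraNF sS => /eqP ->.
  by rewrite inE.
rewrite (_ : (S == [fset s]%fset) = (S `\ s == fset0)%fset); last first.
  apply/eqP/eqP => [->|e]; last by rewrite -(fsetD1K sS) e fsetU0.
  by apply/fsetP => x; rewrite !inE andNb.
case: eqP => _ /=; last by rewrite mulr0.
case: eqP => [->|_]; last by rewrite mulr0.
by rewrite belowE big_seq_fset0 expr0 mulr1.
Qed.

Lemma amul_ut g : amul (umul 0 (tmul 0 (one R))) g = umul 0 (tmul 0 g).
Proof.
have -> : umul 0 (tmul 0 (one R)) = mono 1 ([mset 0%N]%mset, [fset 0%N]%fset).
  apply/funext => -[m S]; rewrite umulE -thvarE /thvar /mono /= !xpair_eqE.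
  have [mm|mm] := boolP (0%N \in m); last first.
    rewrite (_ : (m == _) = false)//; apply: contraNF mm => /eqP ->.
    by rewrite in_mset1.
  congr (if _ && _ then _ else _); apply/eqP/eqP => [e|->].
    by rewrite -(msetB1K mm) e msetDC mset0D.
  by apply/msetP => x; rewrite msetB1E mset0E msetnE; case: eqP.
apply/funext => M; rewrite amul_mono umulE tmulE /= msub1set fsub1set mul1r.
by case: (_ \in _); case: (_ \in _).
Qed.

Lemma amul_tt g : amul (tmul 0 (tmul 1 (one R))) g = tmul 0 (tmul 1 g).
Proof.
have b0 (T : {fset nat}) : below 0 T = 0%N by rewrite belowE big1.
have b1 (T : {fset nat}) : 0%N \notin T -> below 1 T = 0%N.
  move=> T0; rewrite belowE big_seq big1// => -[|x] //.
  by rewrite (negPf T0).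
have DD (S : {fset nat}) : (S `\` [fset 0; 1] = (S `\ 0) `\ 1)%fset.
  by apply/fsetP => x; rewrite !inE negb_or -!andbA andbCA.
have -> : tmul 0 (tmul 1 (one R)) = mono 1 (mset0, [fset 0%N; 1%N]%fset).
  apply/funext => -[m S]; rewrite tmulE -thvarE /thvar /mono /= !xpair_eqE b0 expr0 mul1r.
  have [S0|S0] := boolP (0%N \in S); last first.
    rewrite (_ : (S == _) = false) ?andbF//; apply: contraNF S0 => /eqP ->.
    by rewrite !inE.
  congr (if _ && _ then _ else _); apply/eqP/eqP => [e|->].
    by rewrite -(fsetD1K S0) e.
  by apply/fsetP => x; rewrite !inE; case: x => [|[|]].
apply/funext => -[m S]; rewrite amul_mono !tmulE /= msub0set mul1r b0 expr0 mul1r.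
have -> : ([fset 0%N; 1%N] `<=` S)%fset = (0%N \in S) && (1%N \in (S `\ 0)%fset).
  by rewrite fsubUset !fsub1set !inE.
case: (0%N \in S) => //=; case: ifP => // S1.
rewrite DD b1 ?expr0 ?mul1r; last by rewrite !inE.
have -> : inversions [fset 0%N; 1%N]%fset ((S `\ 0) `\ 1)%fset = 0%N.
  rewrite /inversions big_fsetU1 ?inE//= big_seq_fset1.
  by have := b0 ((S `\ 0) `\ 1)%fset; have := b1 ((S `\ 0) `\ 1)%fset; rewrite !belowE !inE => -> // ->.
rewrite expr0 mul1r; congr (g (_, _)).
by apply/msetP => x; rewrite msetE2 mset0E subn0.
Qed.

End Quotient.

(** * The third bihamiltonian cohomology *)

Section Final.
Variable R : realType.
Local Notation hA := (hatA R).
Implicit Types (f g : hA) (c : cinf R) (M : monomial).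
Local Notation D1 := (@D1 R). Local Notation DD2 := (@DD2 R).
Local Notation half := (cinf_cst (2^-1 : R)).
Local Notation o := (one R).

Lemma cmul_half f : cmul half f + cmul half f = f.
Proof.
have H : half + half = 1.
  by have := @cinf_natV R 2 isT; rewrite mulr_natr mulr2n.
by apply/funext => M; rewrite fctE /cmul -mulrDl H mul1r.
Qed.

Lemma mdx_iter0 s : iter s (@mdx R) 0 = 0.
Proof. exact: (raddf0 (iter s (@mdx R))). Qed.

Lemma dx_tone s : dx (tmul s o) = tmul s.+1 o.
Proof. by rewrite dx_tmul (der_one (isder_dx R)) raddf0 addr0. Qed.

Lemma cmul_half_derive f : cmul (cinf_derive half) f = 0.
Proof. by rewrite cinf_derive_cst; apply/funext => M; rewrite /cmul mul0r. Qed.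

Lemma dx_half f : dx (cmul half f) = cmul half (dx f).
Proof. by rewrite dx_cmul cmul_half_derive add0r. Qed.

Local Notation tt := (tmul 0 (tmul 1 o)).

Lemma pdth_tt s : pdth s tt = if s is 0 then tmul 1 o else if s is 1 then - tmul 0 o else 0.
Proof.
rewrite !pdth_tmul pdth_one (raddf0 (tmul 1)) subr0.
by case: s => [|[|s]]; rewrite /= ?(raddf0 (tmul 0)) ?subr0 ?sub0r.
Qed.

Lemma pdu_tt s : pdu s tt = 0.
Proof. by rewrite !pdu_tmul pdu_one !raddf0. Qed.

Definition density1 : hA := cmul half tt.
Definition density2 : hA := cmul half (cmul (cinf_id R) tt).

Lemma bivector1E : bivector1 R = intF density1.
Proof. by rewrite /bivector1 amul_coef (thvarE _ 1) /density1 tmul.unlock. Qed.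

Lemma bivector2E : bivector2 R = intF density2.
Proof. by rewrite /bivector2 /uvar !amul_coef (thvarE _ 1) /density2 tmul.unlock. Qed.

Lemma pdu_half s f : pdu s (cmul half f) = cmul half (pdu s f).
Proof. by case: s => [|s]; rewrite ?pduS_cmul// pdu0_cmul cmul_half_derive add0r. Qed.

Lemma delta_u_density1 : delta_u density1 = 0.
Proof.
apply/funext => M; rewrite /delta_u /fsum big1// => s _.
by rewrite pdu_half pdu_tt raddf0 mdx_iter0.
Qed.

Lemma delta_u_density2 : delta_u density2 = cmul half tt.
Proof.
rewrite /delta_u (@fsum_fin _ 1) ?big_ord1 /=.
- by rewrite pdu_half pdu0_cmul pdu_tt raddf0 addr0 cinf_derive_id cmul1.
- by move=> s; exact: ordge_iter.
- by move=> [|s] // _; rewrite pdu_half pduS_cmul pdu_tt !raddf0.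
Qed.

Lemma delta_th_density1 : delta_th density1 = tmul 1 o.
Proof.
rewrite /delta_th (@fsum_fin _ 2) ?big_ord_recl ?big_ord0 /= ?addr0.
- rewrite /bump /= !pdth_cmul !pdth_tt /mdx raddfN /= raddfN /= opprK dx_half dx_tone.
  exact: cmul_half.
- by move=> s; exact: ordge_iter.
- by move=> [|[|s]] // _; rewrite pdth_cmul pdth_tt !raddf0.
Qed.

Lemma delta_th_density2 : delta_th density2 = cmul (cinf_id R) (tmul 1 o) + cmul half (umul 0 (tmul 0 o)).
Proof.
rewrite /delta_th (@fsum_fin _ 2) ?big_ord_recl ?big_ord0 /= ?addr0.
- rewrite /bump /= !pdth_cmul !pdth_tt /mdx !raddfN /= opprK dx_half dx_cmul dx_tone.
  rewrite cinf_derive_id cmul1 raddfD /= addrCA addrC; congr (_ + _).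
  exact: cmul_half.
- by move=> s; exact: ordge_iter.
- by move=> [|[|s]] // _; rewrite !pdth_cmul pdth_tt !raddf0.
Qed.

Lemma amul_t f : amul (tmul 1 o) f = tmul 1 f.
Proof. by rewrite -thvarE tmul.unlock. Qed.

Lemma D1_jetder f : D1 f = jetder (fun k => tmul k.+1) (fun _ _ => 0) f.
Proof.
have e : tmul 1 (pdu 0 f) =
    lsum (fun k => if k == 0%N then tmul 1 (pdu 0 f) else 0).
  by rewrite lsum_delta.
rewrite /D1 /dbase e /dR /jetder -lsumD; congr lsum; apply/funext => -[|k] /=.
  by rewrite !addr0 add0r.
by rewrite !addr0.
Qed.

Lemma multop_ord s r T : @multop R s r T -> forall f, ordge r (T f).
Proof. by move=> H f; have := mul_ord H (@ordge0 R f); rewrite addn0. Qed.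

Lemma d1_intF (d : nat) f : proj std_u std_th d f = f -> d1 (intF f) = intF (D1 f).
Proof.
move=> fd; rewrite /d1 /schouten bivector1E !var_uE !var_thE delta_u_density1 delta_th_density1.
rewrite amul0l mul0rz addr0 amul_t D1_jetder.
rewrite -(@intF_jetder R (fun k => tmul k.+1) (fun _ _ => 0) d)// ?addr0//.
- by move=> k g h; rewrite raddfB.
- by move=> k g h; rewrite subr0.
- move=> k g; apply: multop_ord.
  by apply: multopW (multop_t k.+1 (multop_id R)); lia.
- by move=> k g; exact: dx_tmul.
- by move=> k g; rewrite /= ?raddf0 ?addr0.
Qed.

Lemma d2_intF (d : nat) f : proj std_u std_th d f = f ->
  d2 (intF f) + d2 (intF f) = intF (DD2 f).
Proof.
move=> fd; rewrite /d2 /schouten bivector2E !var_uE !var_thE delta_u_density2 delta_th_density2.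
rewrite expr2 mulN1r opprK mulr1z amulDl !amul_cmull amul_t amul_ut amul_tt.
rewrite -raddfD /DD2 -(@intF_jetder R _ _ d)//; first last.
- exact: dx_yop.
- exact: dx_xop.
- move=> k g; apply: multop_ord.
  by apply: multopW (polyop_multop (polyop_yop R k)); lia.
- move=> k g; apply: multop_ord.
  by apply: multopW (multop_xop R k); lia.
- exact: yopB.
- exact: xopB.
congr intF; rewrite /xop /= -{3}(cmul_half (umul 0 (tmul 0 (delta_u f)))).
rewrite -{3}(cmul_half (tmul 0 (tmul 1 (delta_th f)))) /twice_u.
by apply/funext => M; rewrite /cmul !fctE; ring.
Qed.

Lemma homog_bihom p d f : homog p d f -> bihom p d f.
Proof.
move=> H; split; apply/funext => M; rewrite /proj.
  by rewrite wt_supdeg; case: eqP => // e; apply/esym/eqP; apply: contraT => /H[e' _]; rewrite e' in e.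
by rewrite wt_stdeg; case: eqP => // e; apply/esym/eqP; apply: contraT => /H[_ e']; rewrite e' in e.
Qed.

Lemma bihom_dx (p d : int) f : bihom p d f -> bihom p (d + 1) (dx f).
Proof.
by apply: bihom_shift (@wshift_dx_p R) (@wshift_dx R) _ _ => //; rewrite addr0.
Qed.

Lemma dx_bihom_lift (p d : int) f g : bihom p (d + 1) f -> f = dx g ->
  exists2 g', bihom p d g' & f = dx g'.
Proof.
move=> [fp fd] e; exists (proj sup_u sup_th p (proj std_u std_th d g)).
  by split; [rewrite proj_proj eqxx|rewrite projC proj_proj eqxx].
rewrite -(wshift_proj0 (@wshift_dx_p R)) -(@wshift_dx R) -e fd fp //.
Qed.

(** The Poincare lemma on functionals.  The obstruction to lifting a cocycle to
    hatA lies one super degree higher, where D1 is acyclic too. *)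
Lemma d1_acyclic (p : int) (d : nat) f : (1 < d)%N -> bihom p d f -> intF (D1 f) = 0 ->
  exists w v, bihom (p - 1) (d%:Z - 1) w /\ f = D1 w + dx v.
Proof.
move=> d1 fh /intF_eq0[g0 e0].
have [|g gh e] := @dx_bihom_lift (p + 1) d _ _ _ e0.
  by apply: bihom_shift (@wshift_D1_p R) (@wshift_D1_d R) _ _ fh.
have Ag : D1 g = 0.
  apply: (@dx_inj R d.+1) => //; last by rewrite dx_D1 -e D1_D1.
  have [_ ?] : bihom (p + 1 + 1) d.+1%:Z (D1 g); last by [].
  by apply: bihom_shift (@wshift_D1_p R) (@wshift_D1_d R) _ _ gh => //; lia.
have [v vh ev] := D1_acyclic d1 gh Ag.
have fvh : bihom p d (f - dx v).
  apply: bihomB => //; have := bihom_dx vh; rewrite addrK subrK //.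
have fv0 : D1 (f - dx v) = 0 by rewrite raddfB /= -dx_D1 -ev e subrr.
have [w wh ew] := D1_acyclic d1 fvh fv0.
by exists w, v; split=> //; rewrite -ew subrK.
Qed.

(** Sum over S of 2 <= s + 2 [s = 0] + [s = 1]. *)
Lemma card_ge (S : {fset nat}) : (2 * #|` S| <= \sum_(s <- S) s + 3)%N.
Proof.
have H s : (2 <= s + (s == 0) * 2 + (s == 1))%N by case: s => [|[|s]].
have E (P : pred nat) a : (forall s, P s = (s == a)) -> (\sum_(s <- S) (P s) <= 1)%N.
  move=> PE; have [aS|aS] := boolP (a \in S).
    rewrite (big_fsetD1 _ aS) /= PE eqxx big_seq big1 // => s.
    by rewrite in_fsetD1 PE => /andP[/negPf->].
  by rewrite big_seq big1// => s sS; rewrite PE; case: eqP sS aS => // -> ->.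
have e0 := E (fun s => s == 0%N) 0%N (fun=> erefl).
have e1 := E (fun s => s == 1%N) 1%N (fun=> erefl).
have : (\sum_(s <- S) 2 <= \sum_(s <- S) (s + (s == 0) * 2 + (s == 1)))%N by apply: leq_sum.
rewrite big_const_seq count_predT iter_addn_0 !big_split /= -big_distrl /= => L.
apply: leq_trans L _; rewrite -addnA leq_add2l.
exact: (leq_add (leq_mul e0 (leqnn 2)) e1).
Qed.

(** For m = 0 and p = d = 4 there would be four distinct theta^s of total degree
    4, against [card_ge]. *)
Lemma eulpos_ge4 (p : nat) (d : nat) : (p <= 4)%N -> (4 <= d)%N -> eulpos R p d.
Proof.
move=> p4 d4 f m fh fm.
have [|] := boolP `[< exists M, f M != 0 >]; last first.
  move=> /asboolPn H; left; apply/funext => M; apply/eqP; apply: contraT => fM.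
  by case: H; exists M.
move=> /asboolP[M fM]; right; have [fp fd] := fh.
have ep := proj_supp fp fM; have ed := proj_supp fd fM; have em := proj_supp fm fM.
have m0 : 0 <= m by rewrite -em wt_ge0.
have [m1|m1] := eqVneq m 0; last by lia.
have M1 : (size M.1 = 0)%N.
  have : wt jet_u jet_th M = (size M.1)%:Z.
    by rewrite /wt [X in _ + X]big1// addr0 big_const_seq count_predT iter_addr_0 natz.
  by rewrite em m1 => -[].
rewrite wt_supdeg in ep; rewrite wt_stdeg in ed.
have := card_ge M.2; move: ep ed; rewrite /supdeg /stdeg (size0nil M1) big_nil; lia.
Qed.

(** The descent of the pencil cohomology to functionals, and the elimination of
    lambda. *)
Lemma cocycle_coboundary (d : nat) (P : hatF R) : (4 <= d)%N -> P \in cocycles R 3 d ->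
  exists Q : hatF R, P = d1 (d2 Q).
Proof.
move=> d4; rewrite cocyclesE => /and3P[/asboolP[f /homog_bihom fh ->{P}] /eqP P1 /eqP P2].
have fd : proj std_u std_th d f = f by have [] := fh.
have d0 : (1 < d)%N by lia.
move: P1; rewrite (d1_intF fd) => /intF_eq0[g1' e1'].
have [|g1 g1h e1] := @dx_bihom_lift 4 d _ _ _ e1'.
  by apply: bihom_shift (@wshift_D1_p R) (@wshift_D1_d R) _ _ fh.
have : intF (DD2 f) = 0 by rewrite -(d2_intF fd) P2 addr0.
move=> /intF_eq0[g2' e2'].
have [|g2 g2h e2] := @dx_bihom_lift 4 d _ _ _ e2'.
  by apply: bihom_shift (@wshift_DD2_p R) (@wshift_DD2_d R) _ _ fh.
(* g2 - lambda g1, so that dx g is the pencil applied to f. *)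
pose g i : hA := if i is j.+1 then cseq (- g1) j else g2.
have gh i : bihom 4 d (g i).
  by case: i => [|[|i]] //=; [exact: bihomN|exact: bihom0].
have gE i : dx (g i) = pencil (cseq f) i.
  case: i => [|[|i]]; rewrite /pencil /=; first by rewrite subr0 e2.
    by rewrite raddfN /= -e1 (raddf0 DD2) sub0r.
  by rewrite (raddf0 DD2) (raddf0 D1) (raddf0 (@dx R)) subr0.
have g0 i : pencil g i = 0.
  apply: (@dx_inj R d.+1) => //.
    have [_ ?] : bihom 5 d.+1%:Z (pencil g i); last by [].
    by apply: bihom_pencil => j; rewrite (_ : 5 - 1 = 4) // (_ : d.+1%:Z - 1 = d) //; lia.
  rewrite -(pencil_pencil (cseq f) i) /pencil raddfB /= dx_DD2 gE; congr (_ - _).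
  by case: i => [|i]; rewrite ?raddf0// dx_D1 gE.
have gn : bounded 2 g by move=> [|[|i]].
have [y [ny [yh yn ye]]] := pencil_acyclic d0 (@eulpos_ge4 4 d isT d4) gh gn g0.
(* Modulo dx, z is the constant polynomial f; it is killed by the pencil in hatA
   itself. *)
pose z i := cseq f i - dx (y i).
have zh i : bihom 3 d (z i).
  apply: bihomB; first by case: i => [|i] //=; exact: bihom0.
  by have := bihom_dx (yh i); rewrite subrK.
have z0 i : pencil z i = 0.
  rewrite pencilB -gE ye /pencil raddfB /= dx_DD2; apply/eqP; rewrite subr_eq0; apply/eqP.
  by congr (_ - _); case: i => [|i]; rewrite ?raddf0// dx_D1.
have zn : bounded (maxn 1 ny) z.
  move=> [|i]; rewrite geq_max // => /andP[_ ni].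
  by rewrite /z /= yn// raddf0 subr0.
have [l [nl [lh ln le]]] := pencil_acyclic d0 (@eulpos_ge4 3 d isT d4) zh zn z0.
have intz i : intF (cseq f i) = intF (pencil l i).
  by rewrite -le /z raddfB /= intF_dx subr0.
have d3 : (1 < d.-1)%N by lia.
have dE : d%:Z - 1 = d.-1%:Z by lia.
pose w_ok (w : hA) := bihom 1 (d%:Z - 2) w.
have DD2h w : w_ok w -> bihom 2 (d%:Z - 1) (DD2 w).
  by apply: bihom_shift (@wshift_DD2_p R) (@wshift_DD2_d R) _ _ => //; lia.
(* A class l i + DD2 w killed by d1 is D1 w', so that DD2 (l i) = - D1 (DD2 w')
   as functionals. *)
have reduce i w : w_ok w -> intF (D1 (l i + DD2 w)) = 0 ->
    exists2 w', w_ok w' & intF (DD2 (l i)) = - intF (D1 (DD2 w')).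
  move=> wh H; have lwh : bihom 2 d.-1 (l i + DD2 w).
    by rewrite -dE; apply: bihomD; [exact: lh|exact: DD2h].
  have [w' [v [w'h e]]] := d1_acyclic d3 lwh H.
  exists w'; first by move: w'h; rewrite /w_ok (_ : d.-1%:Z - 1 = d%:Z - 2)//; lia.
  have := congr1 DD2 e; rewrite (raddfD DD2) [DD2 (D1 _ + _)](raddfD DD2) /=.
  rewrite DD2_DD2 addr0 -dx_DD2 => ->.
  have /eqP := D1_DD2 w'; rewrite addrC addr_eq0 => /eqP ->.
  by rewrite raddfD /= intF_dx addr0 raddfN.
(* Descending induction on the power i of lambda, from the bound nl. *)
have main k i : (nl <= i + k)%N -> exists2 w, w_ok w & intF (D1 (l i + DD2 w)) = 0.
  elim: k i => [|k IH] i.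
    rewrite addn0 => ni; exists 0; first exact: bihom0.
    by rewrite ln// !raddf0 addr0 !raddf0.
  rewrite addnS -addSn => /IH[w wh H].
  have [w' w'h e] := reduce _ _ wh H; exists w' => //.
  rewrite (raddfD D1) (raddfD (@intF R)) /=; have := intz i.+1; rewrite /= raddf0 /pencil raddfB /= e => /esym/eqP.
  by rewrite subr_eq0 => /eqP <-; rewrite addNr.
have [w wh H] := main nl 0%N (leq_addl _ _).
have [w' w'h e] := reduce _ _ wh H.
exists (- (intF w' + intF w')).
have wd : proj std_u std_th (d - 2)%N w' = w'.
  by have [_] := w'h; rewrite (_ : d%:Z - 2 = (d - 2)%N)//; lia.
have Bwd : proj std_u std_th d.-1 (DD2 w') = DD2 w'.
  by have [_] := DD2h _ w'h; rewrite dE.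
have := intz 0%N; rewrite /= /pencil subr0 e => ->.
by rewrite (raddfN (@d2 R)) (raddfN (@d1 R)) (raddfD (@d2 R)) /= (d2_intF wd) (d1_intF Bwd).
Qed.

End Final.

Theorem theorem1p1 (R : realType) (d : nat) (hd : (4 <= d)%N) :
  forall x : BH R 3 d, x = 0.
Proof.
move=> x; rewrite -[x]reprK; apply/eqP.
have e : 0 = \pi_({ideal_quot (coboundaries R 3 d)})%qT 0 :> BH R 3 d.
  by rewrite piE.
rewrite e -Quotient.idealrBE subr0; apply/asboolP.
by apply: (cocycle_coboundary hd); case: (repr x).
Qed.
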